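(* Let $\varepsilon \in (0, \frac{\pi}{6})$ and let $z \in \mathbb{C}\setminus\{0\}$ satisfy $$\arg z \notin \Big(-\frac{\pi}{3}-\varepsilon,\, -\frac{\pi}{3}+\varepsilon\Big) \mod 2\pi .$$ Then $$\left| \frac{\mathfrak{A}(z)}{\mathfrak{A}_{\mathrm{WKB}}(z)} - 1 \right| \leq \frac{3}{|z|^{3/4}}\, \frac{1}{\sin^2(\varepsilon/2)} \left(1 + \log^2 \big(1 + \sin^{3/2}(\varepsilon/2)\, |z|^{3/4} \big) \right)$$ and $$\left| \frac{d}{dz} \left( \frac{\mathfrak{A}(z)}{\mathfrak{A}_{\mathrm{WKB}}(z)} \right) \right| \leq \frac{2}{|z|^{7/4}}\, \frac{1}{\sin^3(\varepsilon/2)} \left(1 + \log^3 \big(1 + \sin^{3/2}(\varepsilon/2)\, |z|^{3/4} \big) \right).$$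
   Context: $\mathrm{Ai}$ and $\mathrm{Bi}$ are the standard Airy functions, and $\mathfrak{A}(z) := -i\sqrt{\pi}\,\big(\mathrm{Ai}(z) + i\,\mathrm{Bi}(z)\big)$. Equivalently, $$\mathfrak{A}(z) = \frac{1}{\sqrt{\pi}} \int_\Gamma \exp\Big(\frac{t^3}{3} - zt\Big)\,dt,$$ where $\Gamma = -\mathbb{R}^+ \cup e^{-i\pi/3}\mathbb{R}^+$ is the contour running from $-\infty$ to $\infty e^{-i\pi/3}$. The WKB wave function is $\mathfrak{A}_{\mathrm{WKB}}(z) := z^{-1/4}\, e^{\frac{2}{3} z^{3/2}}$. All powers are defined by $z^\alpha = \exp(\alpha \log z)$, where the logarithm has its branch cut along the ray $e^{-i\pi/3}\mathbb{R}^+$, i.e. $\log z = \log|z| + i\arg z$ with $\arg z \in (-\frac{\pi}{3}, \frac{5\pi}{3})$. Powers of sine: $\sin^{p}(x) = (\sin x)^p$, and $\log^p(x) = (\log x)^p$. *)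

(* Defs.v *)
From Stdlib Require Import Reals Lra.
From Coquelicot Require Import Coquelicot.
Open Scope R_scope.

Definition Cexp (z : C) : C := (exp (Re z) * cos (Im z), exp (Re z) * sin (Im z)).

Definition cis (theta : R) : C := (cos theta, sin theta).

(** All the values of the argument, not only one branch. *)
Definition is_arg (z : C) (theta : R) : Prop := z = (RtoC (Cmod z) * cis theta)%C.

(** Principal argument, in (-PI, PI]. *)
Definition Arg (z : C) : R :=
  if Rle_dec 0 (Im z) then acos (Re z / Cmod z) else - acos (Re z / Cmod z).

(** The branch of the argument cut along the ray of direction - PI / 3, obtained
    by rotating that ray onto the negative real axis.  Values are in
    (- PI / 3, 5 * PI / 3); on the cut itself, where the mathematical function is
    undefined, the value is 5 * PI / 3. *)
Definition arg_cut (z : C) : R := 2 * PI / 3 + Arg (z * cis (- (2 * PI / 3)))%C.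

Definition Clog (z : C) : C := (ln (Cmod z), arg_cut z).

Definition Cpowr (z : C) (alpha : R) : C := Cexp (RtoC alpha * Clog z)%C.

(** Integral of [f] along the ray from 0 to infinity in direction [theta]. *)
Definition ray_int (f : C -> C) (theta : R) : C :=
  RInt_gen (V := C_R_CompleteNormedModule)
    (fun s : R => (f (RtoC s * cis theta) * cis theta)%C)
    (at_point 0) (Rbar_locally p_infty).

(** Integral along the contour that comes from infinity in direction [alpha] to 0
    and goes back to infinity in direction [beta]. *)
Definition contour_int (f : C -> C) (alpha beta : R) : C :=
  (ray_int f beta - ray_int f alpha)%C.

Definition airy_integrand (z t : C) : C := Cexp (t ^ 3 / RtoC 3 - z * t)%C.

(** Ai and Bi on the complex plane by their standard contour integrals
    (DLMF 9.5.4 and 9.5.5). *)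
Definition Ai (z : C) : C :=
  (/ (RtoC (2 * PI) * Ci) * contour_int (airy_integrand z) (- (PI / 3)) (PI / 3))%C.

Definition Bi (z : C) : C :=
  (/ RtoC (2 * PI) * contour_int (airy_integrand z) PI (PI / 3) +
   / RtoC (2 * PI) * contour_int (airy_integrand z) PI (- (PI / 3)))%C.

Definition airyA (z : C) : C := (- Ci * RtoC (sqrt PI) * (Ai z + Ci * Bi z))%C.

Definition airyA_WKB (z : C) : C :=
  (Cpowr z (- (1 / 4)) * Cexp (RtoC (2 / 3) * Cpowr z (3 / 2)))%C.

Lemma airyA_contour (z : C) :
  airyA z = (/ RtoC (sqrt PI) * contour_int (airy_integrand z) PI (- (PI / 3)))%C.
Proof.
  unfold airyA, Ai, Bi, contour_int.
  generalize (ray_int (airy_integrand z) (PI / 3))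
    (ray_int (airy_integrand z) (- (PI / 3))) (ray_int (airy_integrand z) PI).
  intros a b c.
  assert (hs : sqrt PI <> 0).
  { apply Rgt_not_eq, sqrt_lt_R0, PI_RGT_0. }
  assert (hsC : RtoC (sqrt PI) <> 0%C) by (intros h; apply hs, RtoC_inj, h).
  assert (h2 : RtoC 2 <> 0%C) by (intros h; apply RtoC_inj in h; lra).
  replace (RtoC (2 * PI)) with (RtoC 2 * (RtoC (sqrt PI) * RtoC (sqrt PI)))%C.
  2:{ rewrite <- !RtoC_mult, sqrt_sqrt; [reflexivity | apply Rlt_le, PI_RGT_0]. }
  assert (hi : (Ci * Ci = - (1))%C).
  { unfold Ci, Cmult, Copp, RtoC; simpl; f_equal; ring. }
  set (w := RtoC (sqrt PI)) in *.
  transitivity ((/ (2 * w)) * (- (a - b) - (Ci * Ci) * ((a - c) + (b - c))))%C.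
  - field; repeat split; auto using Ci_nz.
  - rewrite hi. field; auto.
Qed.

Lemma Arg_spec (z : C) : z <> 0%C -> - PI < Arg z <= PI /\ is_arg z (Arg z).
Proof.
  intros hz.
  assert (hm : 0 < Cmod z) by (apply Cmod_gt_0, hz).
  assert (hsq : Cmod z ^ 2 = Re z ^ 2 + Im z ^ 2) by apply Cmod2_alt.
  set (x := Re z / Cmod z).
  assert (hx : Re z = Cmod z * x) by (unfold x; field; lra).
  assert (hx1 : -1 <= x <= 1).
  { rewrite hx in hsq. assert (0 < Cmod z ^ 2) by nra.
    assert (x ^ 2 <= 1) by nra. nra. }
  assert (hc : cos (acos x) = x) by (apply cos_acos; lra).
  assert (hsin : Cmod z * sin (acos x) = Rabs (Im z)).
  { rewrite sin_acos by lra.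
    rewrite <- (sqrt_pow2 (Cmod z)) by lra.
    rewrite <- sqrt_mult by (unfold Rsqr; nra).
    rewrite <- sqrt_Rsqr_abs. f_equal. unfold Rsqr. rewrite hx in hsq. nra. }
  pose proof (acos_bound x) as hb.
  unfold Arg, is_arg. fold x. destruct (Rle_dec 0 (Im z)) as [h | h].
  - rewrite Rabs_pos_eq in hsin by lra. split; [pose proof PI_RGT_0; lra |].
    unfold cis, RtoC, Cmult. rewrite (surjective_pairing z) at 1. simpl.
    rewrite hc. fold (Re z) (Im z). f_equal; nra.
  - rewrite Rabs_left in hsin by lra.
    assert (acos x <> PI).
    { intros e. rewrite e, sin_PI in hsin. lra. }
    split; [pose proof PI_RGT_0; lra |].
    unfold cis, RtoC, Cmult. rewrite (surjective_pairing z) at 1. simpl.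
    rewrite cos_neg, sin_neg, hc. fold (Re z) (Im z). f_equal; nra.
Qed.

Lemma cis_add (a b : R) : cis (a + b) = (cis a * cis b)%C.
Proof.
  unfold cis, Cmult; simpl. rewrite cos_plus, sin_plus. f_equal; ring.
Qed.

Lemma cis_0 : cis 0 = 1%C.
Proof. unfold cis. rewrite cos_0, sin_0. reflexivity. Qed.

Lemma Cmod_cis (a : R) : Cmod (cis a) = 1.
Proof.
  unfold Cmod, cis; simpl.
  replace (cos a * (cos a * 1) + sin a * (sin a * 1)) with (Rsqr (sin a) + Rsqr (cos a))
    by (unfold Rsqr; ring).
  rewrite sin2_cos2. apply sqrt_1.
Qed.

Lemma arg_cut_spec (z : C) :
  z <> 0%C -> - (PI / 3) < arg_cut z <= 5 * PI / 3 /\ is_arg z (arg_cut z).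
Proof.
  intros hz. unfold arg_cut. set (b := 2 * PI / 3).
  assert (hw : (z * cis (- b))%C <> 0%C).
  { apply Cmult_neq_0; [exact hz |]. apply Cmod_gt_0. rewrite Cmod_cis. lra. }
  destruct (Arg_spec _ hw) as [hb ha].
  split; [unfold b in *; lra |].
  unfold is_arg in *. rewrite Cmod_mult, Cmod_cis, Rmult_1_r in ha.
  rewrite cis_add.
  transitivity (z * cis (- b) * cis b)%C.
  - rewrite <- Cmult_assoc, <- cis_add.
    replace (- b + b) with 0 by ring. rewrite cis_0. ring.
  - rewrite ha at 1. ring.
Qed.

(* Main.v *)
Require Import Defs.
From Stdlib Require Import Reals Lra.
From Coquelicot Require Import Coquelicot.
Open Scope R_scope.

(** Put w = z exp(-2 i PI/3), b = w^(1/4) and a = b^2 = w^(1/2), the branch being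
    the one cut along the negative real axis of w; that cut is the given cut of z.
    Off the cut, b has argument in (-PI/4, PI/4) and Re a > 0.

    Rotating the contour by 2 PI/3 turns the integrand into exp(t^3/3 - a^2 t) and
    the contour into the two rays of direction -PI/3 and PI/3.  The saddle point is
    t = a, and on the vertical line t = a + i s the exponent is exactly
    - 2 a^3/3 - a s^2 - i s^3/3.  Moving the contour to that line ([airyA_saddle])
    gives a formula without error term,
      airyA z / airyA_WKB z = (2 / sqrt PI) b J(b^2),
      J(a) = int_0^oo exp(- a s^2) cos(s^3/3) ds.
    Without the cosine this quotient would be the Gaussian integral, hence 1
    ([gauss_int_1]).  Therefore ([airyA_quotient])
      airyA z / airyA_WKB z - 1 = (2 / sqrt PI) b D(b^2),
      D(a) = int_0^oo exp(- a s^2) (cos(s^3/3) - 1) ds.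

    As |cos x - 1| <= |x|, the integral D(a) is at most a third moment of the
    Gaussian with parameter Re a, so |D(a)| <= 1 / (6 (Re a)^2), and its derivative
    is at most a fifth moment, |D'(a)| <= 1 / (3 (Re a)^3).  Staying at angle eps
    from the cut means Re a >= |b|^2 sin(eps/2) ([Re_airy_root_sq_ge]).  Since
    |b| = |z|^(1/4), this gives
      |quotient - 1| <= (1/3) |z|^(-3/4) / sin^2(eps/2),
      |quotient'| <= (5/12) |z|^(-7/4) / sin^3(eps/2),
    which is stronger than what is claimed because each logarithmic factor is at
    least 1.

    The contour is moved with an explicit entire primitive of the integrand: the
    ray and the vertical line are joined by horizontal segments on which the
    integrand decays ([ray_meets_saddle_line]). *)

(** * Complex differentiation with quadratic remainder *)

Lemma Cexp_add (u v : C) : Cexp (u + v) = (Cexp u * Cexp v)%C.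
Proof.
  unfold Cexp, Cmult, Cplus, Re, Im; simpl.
  rewrite exp_plus, cos_plus, sin_plus; f_equal; ring.
Qed.

Lemma Cexp_0 : Cexp 0 = 1%C.
Proof.
  unfold Cexp, RtoC, Re, Im; simpl. rewrite exp_0, cos_0, sin_0; f_equal; ring.
Qed.

Lemma Cmod_Cexp (u : C) : Cmod (Cexp u) = exp (Re u).
Proof.
  replace (Cexp u) with (RtoC (exp (Re u)) * cis (Im u))%C
    by (unfold Cexp, cis, Cmult, RtoC; simpl; f_equal; ring).
  rewrite Cmod_mult, Cmod_cis, Cmod_R, Rabs_pos_eq; [ring | apply Rlt_le, exp_pos].
Qed.

Lemma exp_le (x y : R) : x <= y -> exp x <= exp y.
Proof. intros [h | ->]; [apply Rlt_le, exp_increasing, h | lra]. Qed.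

Lemma Re_le_Cmod (u : C) : Re u <= Cmod u.
Proof. apply Rle_trans with (1 := Rle_abs _), re_le_Cmod. Qed.

Lemma Cmod_Cexp_le (u : C) : Cmod (Cexp u) <= exp (Cmod u).
Proof. rewrite Cmod_Cexp. apply exp_le, Re_le_Cmod. Qed.

Lemma Cmod_minus_le (u v : C) : Cmod (u - v) <= Cmod u + Cmod v.
Proof. unfold Cminus. rewrite <- (Cmod_opp v). apply Cmod_triangle. Qed.

Lemma is_derive_pair (f g : R -> R) (t df dg : R) :
  is_derive f t df -> is_derive g t dg ->
  is_derive (V := C_R_NormedModule) (fun s => (f s, g s) : C) t (df, dg).
Proof.
  intros hf hg.
  apply (filterdiff_comp'_2 (K := R_AbsRing) (T := R_NormedModule)
    (U := R_NormedModule) (V := R_NormedModule) (W := C_R_NormedModule)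
    f g (fun x y => (x, y)) t (fun y => scal y df) (fun y => scal y dg) (fun x y => (x, y)));
    [exact hf | exact hg |].
  apply (filterdiff_ext_lin _ (fun x => x)); [| intros [x y]; reflexivity].
  apply (filterdiff_ext (fun x => x)); [intros [x y]; reflexivity | apply filterdiff_id].
Qed.

Lemma is_derive_Cexp_line (h : C) (t : R) :
  is_derive (V := C_R_NormedModule) (fun s : R => Cexp (RtoC s * h)) t
    (h * Cexp (RtoC t * h))%C.
Proof.
  destruct h as [x y].
  replace ((x, y) * Cexp (RtoC t * (x, y)))%C with
    ((x * exp (t * x) * cos (t * y) - y * exp (t * x) * sin (t * y),
      x * exp (t * x) * sin (t * y) + y * exp (t * x) * cos (t * y)) : C).
  2:{ unfold Cexp, Cmult, RtoC, Re, Im; simpl.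
      rewrite !Rmult_0_l, Rminus_0_r, Rplus_0_r. f_equal; ring. }
  apply (is_derive_ext (fun s : R => (exp (s * x) * cos (s * y), exp (s * x) * sin (s * y)) : C)).
  { intros s. unfold Cexp, Cmult, RtoC, Re, Im; simpl.
    rewrite !Rmult_0_l, Rminus_0_r, Rplus_0_r. reflexivity. }
  apply is_derive_pair; auto_derive; auto; ring.
Qed.

Lemma RInt_Cmod_le (f : R -> C) (a b : R) (l : C) (M : R) :
  a <= b -> (forall x, a <= x <= b -> Cmod (f x) <= M) ->
  is_RInt (V := C_R_NormedModule) f a b l -> Cmod l <= (b - a) * M.
Proof.
  intros hab hf hl. rewrite Cmod_norm.
  apply (norm_RInt_le_const (V := C_R_NormedModule) f a b l M hab); auto.
  intros x hx. rewrite <- Cmod_norm. auto.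
Qed.

Lemma is_RInt_C_derive (f df : R -> C) (a b : R) :
  (forall x, is_derive (V := C_R_NormedModule) f x (df x)) ->
  (forall x, continuous (U := C_R_NormedModule) df x) ->
  is_RInt (V := C_R_NormedModule) df a b (f b - f a)%C.
Proof.
  intros hf hdf.
  apply (is_RInt_derive (V := C_R_CompleteNormedModule) f df a b); intros; auto.
Qed.

Lemma C_mean_value (f df : R -> C) (a b M : R) :
  a <= b ->
  (forall x, is_derive (V := C_R_NormedModule) f x (df x)) ->
  (forall x, continuous (U := C_R_NormedModule) df x) ->
  (forall x, a <= x <= b -> Cmod (df x) <= M) ->
  Cmod (f b - f a) <= (b - a) * M.
Proof.
  intros hab hf hdf hM. apply RInt_Cmod_le with (1 := hab) (2 := hM).
  apply is_RInt_C_derive; auto.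
Qed.

Lemma is_linear_Cmult (c : C) :
  is_linear (K := R_AbsRing) (U := C_R_NormedModule) (V := C_R_NormedModule)
    (fun u : C => (c * u)%C).
Proof.
  split.
  - intros x y. exact (Cmult_plus_distr_l c x y).
  - intros k x. rewrite !scal_R_Cmult. change (c * (k * x) = k * (c * x))%C. ring.
  - exists (Cmod c + 1). pose proof (Cmod_ge_0 c). split; [lra |].
    intros x. rewrite <- !Cmod_norm, Cmod_mult. pose proof (Cmod_ge_0 x). nra.
Qed.

Lemma is_derive_C_mult_const (f : R -> C) (c l : C) (t : R) :
  is_derive (V := C_R_NormedModule) f t l ->
  is_derive (V := C_R_NormedModule) (fun s => c * f s)%C t (c * l)%C.
Proof.
  intros hf.
  apply (filterdiff_ext_lin _ (fun y => (c * scal (V := C_R_NormedModule) y l)%C)).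
  2:{ intros y. rewrite !scal_R_Cmult. change (c * (y * l) = y * (c * l))%C. ring. }
  apply (filterdiff_comp' (U := R_NormedModule) (V := C_R_NormedModule)
    (W := C_R_NormedModule) f (fun u : C => (c * u)%C) t _ (fun u : C => (c * u)%C)); auto.
  apply filterdiff_linear, is_linear_Cmult.
Qed.

Lemma continuous_C_mult_const (f : R -> C) (c : C) (t : R) :
  continuous (U := C_R_NormedModule) f t ->
  continuous (U := C_R_NormedModule) (fun s => c * f s)%C t.
Proof.
  intros hf.
  apply (continuous_comp (V := C_R_NormedModule) (W := C_R_NormedModule) f (fun u : C => (c * u)%C));
    [exact hf | apply linear_cont, is_linear_Cmult].
Qed.

Lemma is_RInt_C_mult_const (f : R -> C) (c l : C) (a b : R) :
  is_RInt (V := C_R_NormedModule) f a b l ->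
  is_RInt (V := C_R_NormedModule) (fun s => c * f s)%C a b (c * l)%C.
Proof.
  intros hf.
  pose proof (is_RInt_fct_extend_fst (U := R_NormedModule) (V := R_NormedModule) f a b l hf) as h1.
  pose proof (is_RInt_fct_extend_snd (U := R_NormedModule) (V := R_NormedModule) f a b l hf) as h2.
  apply (is_RInt_fct_extend_pair (U := R_NormedModule) (V := R_NormedModule)
    (fun s => c * f s)%C a b (fst c * fst l - snd c * snd l) (fst c * snd l + snd c * fst l)).
  - exact (is_RInt_minus _ _ _ _ _ _ (is_RInt_scal _ _ _ _ _ h1) (is_RInt_scal _ _ _ _ _ h2)).
  - exact (is_RInt_plus _ _ _ _ _ _ (is_RInt_scal _ _ _ _ _ h2) (is_RInt_scal _ _ _ _ _ h1)).
Qed.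

(** Both Taylor estimates come from the mean value inequality along the segment
    from 0 to [h]; the second one uses the first to bound the derivative. *)
Lemma Cexp_taylor1 (h : C) : Cmod (Cexp h - 1) <= Cmod h * exp (Cmod h).
Proof.
  replace (Cexp h - 1)%C with (Cexp (RtoC 1 * h) - Cexp (RtoC 0 * h))%C.
  2:{ rewrite Cmult_1_l, Cmult_0_l, Cexp_0. reflexivity. }
  replace (Cmod h * exp (Cmod h)) with ((1 - 0) * (Cmod h * exp (Cmod h))) by ring.
  apply (C_mean_value (fun t => Cexp (RtoC t * h)) (fun t => h * Cexp (RtoC t * h))%C);
    [lra | intros; apply is_derive_Cexp_line | |].
  - intros x. apply (ex_derive_continuous (V := C_R_NormedModule)). eexists.
    apply is_derive_C_mult_const, is_derive_Cexp_line.
  - intros x hx. rewrite Cmod_mult.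
    apply Rmult_le_compat_l; [apply Cmod_ge_0 |].
    apply Rle_trans with (1 := Cmod_Cexp_le _), exp_le.
    rewrite Cmod_mult, Cmod_R, Rabs_pos_eq by lra.
    pose proof (Cmod_ge_0 h). nra.
Qed.

Lemma Cexp_taylor2 (h : C) : Cmod (Cexp h - 1 - h) <= Cmod h ^ 2 * exp (Cmod h).
Proof.
  replace (Cexp h - 1 - h)%C with
   ((Cexp (RtoC 1 * h) - RtoC 1 * h) - (Cexp (RtoC 0 * h) - RtoC 0 * h))%C.
  2:{ rewrite Cmult_1_l, Cmult_0_l, Cexp_0. ring. }
  replace (Cmod h ^ 2 * exp (Cmod h)) with ((1 - 0) * (Cmod h * (Cmod h * exp (Cmod h)))) by ring.
  assert (hd : forall t : R, is_derive (V := C_R_NormedModule)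
    (fun s : R => RtoC s * h)%C t h).
  { intros t. destruct h as [x y].
    apply (is_derive_ext (fun s : R => (s * x, s * y) : C)).
    { intros s. unfold Cmult, RtoC; simpl. f_equal; ring. }
    apply is_derive_pair; auto_derive; auto; ring. }
  apply (C_mean_value (fun t => Cexp (RtoC t * h) - RtoC t * h)%C
    (fun t => h * Cexp (RtoC t * h) - h)%C); [lra | | |].
  - intros t. apply (is_derive_minus (V := C_R_NormedModule)); auto using is_derive_Cexp_line.
  - intros x. apply (continuous_minus (V := C_R_NormedModule)); [| apply continuous_const].
    apply (ex_derive_continuous (V := C_R_NormedModule)). eexists.
    apply is_derive_C_mult_const, is_derive_Cexp_line.
  - intros x hx.
    replace (h * Cexp (RtoC x * h) - h)%C with (h * (Cexp (RtoC x * h) - 1))%C by ring.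
    rewrite Cmod_mult.
    apply Rmult_le_compat_l; [apply Cmod_ge_0 |].
    apply Rle_trans with (1 := Cexp_taylor1 _).
    assert (hm : Cmod (RtoC x * h) <= Cmod h).
    { rewrite Cmod_mult, Cmod_R, Rabs_pos_eq by lra. pose proof (Cmod_ge_0 h). nra. }
    apply Rmult_le_compat; auto using Cmod_ge_0, exp_le. apply Rlt_le, exp_pos.
Qed.

(** Complex differentiability with a remainder of second order.  Analytic functions
    satisfy this stronger form, and a quadratic remainder bound, unlike a limit, can
    simply be integrated: differentiation under the integral sign needs no further
    argument. *)
Definition qderiv (f : C -> C) (z l : C) : Prop :=
  exists M d : R, 0 <= M /\ 0 < d /\
    forall h : C, Cmod h < d -> Cmod (f (z + h) - f z - l * h)%C <= M * Cmod h ^ 2.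

Lemma qderiv_id (z : C) : qderiv (fun u => u) z 1.
Proof.
  exists 0, 1. repeat split; try lra. intros h _.
  replace (z + h - z - 1 * h)%C with (RtoC 0) by ring. rewrite Cmod_0. lra.
Qed.

Lemma qderiv_const (c z : C) : qderiv (fun _ => c) z 0.
Proof.
  exists 0, 1. repeat split; try lra. intros h _.
  replace (c - c - 0 * h)%C with (RtoC 0) by ring. rewrite Cmod_0. lra.
Qed.

Lemma qderiv_Cexp (z : C) : qderiv Cexp z (Cexp z).
Proof.
  exists (Cmod (Cexp z) * exp 1), 1. pose proof (exp_pos 1). pose proof (Cmod_ge_0 (Cexp z)).
  repeat split; try lra; [nra |]. intros h hh.
  replace (Cexp (z + h) - Cexp z - Cexp z * h)%C with (Cexp z * (Cexp h - 1 - h))%C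
    by (rewrite Cexp_add; ring).
  rewrite Cmod_mult, Rmult_assoc. apply Rmult_le_compat_l; [lra |].
  apply Rle_trans with (1 := Cexp_taylor2 h). rewrite Rmult_comm.
  apply Rmult_le_compat_r; [apply pow2_ge_0 | apply exp_le; lra].
Qed.

Lemma qderiv_lipschitz (f : C -> C) (z l : C) : qderiv f z l ->
  exists K d, 0 <= K /\ 0 < d /\
    forall h, Cmod h < d -> Cmod (f (z + h) - f z)%C <= K * Cmod h.
Proof.
  intros (M & d & hM & hd & hf).
  exists (M * d + Cmod l), d. pose proof (Cmod_ge_0 l).
  repeat split; auto; [nra |]. intros h hh.
  replace (f (z + h) - f z)%C with ((f (z + h) - f z - l * h) + l * h)%C by ring.
  apply Rle_trans with (1 := Cmod_triangle _ _). rewrite Cmod_mult.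
  pose proof (hf h hh). pose proof (Cmod_ge_0 h).
  assert (M * Cmod h ^ 2 <= M * d * Cmod h).
  { assert (0 <= M * Cmod h * (d - Cmod h)) by (repeat apply Rmult_le_pos; lra). simpl; lra. }
  lra.
Qed.

Lemma qderiv_plus (f g : C -> C) (z l m : C) :
  qderiv f z l -> qderiv g z m -> qderiv (fun u => f u + g u)%C z (l + m)%C.
Proof.
  intros (M & d & hM & hd & hf) (N & e & hN & he & hg).
  exists (M + N), (Rmin d e). repeat split; [lra | apply Rmin_pos; auto |].
  intros h hh. apply Rmin_Rgt in hh as [h1 h2].
  replace (f (z + h) + g (z + h) - (f z + g z) - (l + m) * h)%C with
    ((f (z + h) - f z - l * h) + (g (z + h) - g z - m * h))%C by ring.
  apply Rle_trans with (1 := Cmod_triangle _ _).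
  rewrite Rmult_plus_distr_r. apply Rplus_le_compat; auto.
Qed.

Lemma qderiv_opp (f : C -> C) (z l : C) : qderiv f z l -> qderiv (fun u => - f u)%C z (- l)%C.
Proof.
  intros (M & d & hM & hd & hf). exists M, d. repeat split; auto. intros h hh.
  replace (- f (z + h) - - f z - - l * h)%C with (- (f (z + h) - f z - l * h))%C by ring.
  rewrite Cmod_opp. auto.
Qed.

Lemma qderiv_mult (f g : C -> C) (z l m : C) :
  qderiv f z l -> qderiv g z m ->
  qderiv (fun u => f u * g u)%C z (l * g z + f z * m)%C.
Proof.
  intros hf hg.
  destruct (qderiv_lipschitz _ _ _ hf) as (K & d1 & hK & hd1 & h1).
  destruct (qderiv_lipschitz _ _ _ hg) as (L & d2 & hL & hd2 & h2).
  destruct hf as (M & d3 & hM & hd3 & h3). destruct hg as (N & d4 & hN & hd4 & h4).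
  exists (K * L + M * Cmod (g z) + N * Cmod (f z)), (Rmin (Rmin d1 d2) (Rmin d3 d4)).
  pose proof (Cmod_ge_0 (g z)). pose proof (Cmod_ge_0 (f z)).
  repeat split; [nra | repeat apply Rmin_pos; auto |].
  intros h hh. apply Rmin_Rgt in hh as [hh hh']. apply Rmin_Rgt in hh as [e1 e2].
  apply Rmin_Rgt in hh' as [e3 e4].
  specialize (h1 h e1). specialize (h2 h e2). specialize (h3 h e3). specialize (h4 h e4).
  replace (f (z + h) * g (z + h) - f z * g z - (l * g z + f z * m) * h)%C with
    ((f (z + h) - f z) * (g (z + h) - g z) + (f (z + h) - f z - l * h) * g z
     + (g (z + h) - g z - m * h) * f z)%C by ring.
  apply Rle_trans with (1 := Cmod_triangle _ _).
  apply Rle_trans with (1 := Rplus_le_compat_r _ _ _ (Cmod_triangle _ _)).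
  rewrite !Cmod_mult.
  pose proof (Rmult_le_compat _ _ _ _ (Cmod_ge_0 _) (Cmod_ge_0 _) h1 h2).
  pose proof (Rmult_le_compat_r _ _ _ (Cmod_ge_0 (g z)) h3).
  pose proof (Rmult_le_compat_r _ _ _ (Cmod_ge_0 (f z)) h4).
  nra.
Qed.

Lemma qderiv_comp (f g : C -> C) (z l m : C) :
  qderiv f (g z) l -> qderiv g z m -> qderiv (fun u => f (g u)) z (l * m)%C.
Proof.
  intros (M & d & hM & hd & h1) hg.
  destruct (qderiv_lipschitz _ _ _ hg) as (L & d2 & hL & hd2 & h2).
  destruct hg as (N & d4 & hN & hd4 & h4).
  exists (M * L ^ 2 + Cmod l * N), (Rmin (Rmin d2 d4) (d / (L + 1))).
  pose proof (Cmod_ge_0 l). pose proof (pow2_ge_0 L).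
  assert (0 < d / (L + 1)) by (apply Rdiv_lt_0_compat; lra).
  repeat split; [nra | repeat apply Rmin_pos; auto |].
  intros h hh. apply Rmin_Rgt in hh as [hh e1]. apply Rmin_Rgt in hh as [e2 e4].
  specialize (h2 h e2). specialize (h4 h e4). pose proof (Cmod_ge_0 h).
  set (k := (g (z + h) - g z)%C) in *.
  assert (hk : Cmod k < d).
  { apply Rle_lt_trans with (1 := h2).
    apply Rmult_gt_compat_l with (r := L + 1) in e1; [| lra].
    replace ((L + 1) * (d / (L + 1))) with d in e1 by (field; lra). nra. }
  specialize (h1 k hk).
  replace (f (g (z + h)) - f (g z) - l * m * h)%C with
    ((f (g z + k) - f (g z) - l * k) + l * (k - m * h))%C.
  2:{ replace (g z + k)%C with (g (z + h))%C by (unfold k; ring). ring. }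
  apply Rle_trans with (1 := Cmod_triangle _ _). rewrite Cmod_mult.
  pose proof (Rmult_le_compat_l _ _ _ (Cmod_ge_0 l) h4).
  assert (Cmod k ^ 2 <= (L * Cmod h) ^ 2) by (apply pow_incr; split; [apply Cmod_ge_0 | lra]).
  assert (M * Cmod k ^ 2 <= M * (L * Cmod h) ^ 2) by (apply Rmult_le_compat_l; auto).
  nra.
Qed.

Lemma qderiv_eq (f : C -> C) (z l m : C) : qderiv f z l -> l = m -> qderiv f z m.
Proof. intros h <-. exact h. Qed.

(** Computes the derivative of an expression built from constants, the variable, the
    ring operations and [Cexp], leaving it in the form given by the rules. *)
Ltac qderiv_auto :=
  lazymatch goal with
  | |- qderiv (fun u => (@?f u + @?g u)%C) ?z _ => eapply (qderiv_plus f g z); qderiv_auto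
  | |- qderiv (fun u => (@?f u - @?g u)%C) ?z _ =>
      eapply (qderiv_plus f (fun u => - g u)%C z); qderiv_auto
  | |- qderiv (fun u => (- @?f u)%C) ?z _ => eapply (qderiv_opp f z); qderiv_auto
  | |- qderiv (fun u => (@?f u * @?g u)%C) ?z _ => eapply (qderiv_mult f g z); qderiv_auto
  | |- qderiv (fun u => Cexp (@?f u)) ?z _ =>
      eapply (qderiv_comp Cexp f z); [apply qderiv_Cexp | qderiv_auto]
  | |- qderiv (fun u => u) _ _ => apply qderiv_id
  | |- qderiv (fun _ => ?c) _ _ => apply qderiv_const
  end.

Lemma qderiv_ext_loc (f g : C -> C) (z l : C) (r : R) :
  0 < r -> (forall h, Cmod h < r -> f (z + h)%C = g (z + h)%C) -> qderiv f z l -> qderiv g z l.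
Proof.
  intros hr he (M & d & hM & hd & hf). exists M, (Rmin d r).
  repeat split; auto; [apply Rmin_pos; auto |].
  intros h hh. apply Rmin_Rgt in hh as [e1 e2].
  rewrite <- he by auto. specialize (he 0%C). rewrite Cplus_0_r in he.
  rewrite <- he by (rewrite Cmod_0; auto). auto.
Qed.

Lemma qderiv_is_derive (f : C -> C) (z l : C) :
  qderiv f z l -> is_derive (K := C_AbsRing) (V := C_NormedModule) f z l.
Proof.
  intros (M & d & hM & hd & hf). split; [apply is_linear_scal_l |].
  intros x hx. apply (is_filter_lim_locally_unique (V := AbsRing_NormedModule C_AbsRing)) in hx. subst x.
  intros eps.
  assert (hr : 0 < Rmin d (eps / (M + 1))).
  { apply Rmin_pos; [auto | apply Rdiv_lt_0_compat; [apply cond_pos | lra]]. }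
  exists (mkposreal _ hr). intros y hy.
  change (Cmod (y - z) < Rmin d (eps / (M + 1))) in hy.
  change (Cmod (f y - f z - (y - z) * l) <= eps * Cmod (y - z)).
  apply Rmin_Rgt in hy as [h1 h2]. pose proof (cond_pos eps).
  specialize (hf (y - z)%C h1).
  assert (e : forall u v : C, (v + (u - v))%C = u) by (intros; ring).
  rewrite e in hf.
  rewrite Cmult_comm in hf.
  apply Rle_trans with (1 := hf). pose proof (Cmod_ge_0 (y - z)).
  apply Rmult_gt_compat_l with (r := M + 1) in h2; [| lra].
  replace ((M + 1) * (eps / (M + 1))) with (pos eps) in h2 by (field; lra).
  simpl. rewrite Rmult_1_r, <- Rmult_assoc. apply Rmult_le_compat_r; nra.
Qed.

Lemma qderiv_line (f : C -> C) (p q : C) (t : R) (l : C) :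
  qderiv f (p + RtoC t * q)%C l ->
  is_derive (V := C_R_NormedModule) (fun s : R => f (p + RtoC s * q)%C) t (l * q)%C.
Proof.
  intros (M & d & hM & hd & hf). split; [apply (is_linear_scal_l (V := C_R_NormedModule)) |].
  intros x hx. apply (is_filter_lim_locally_unique (V := R_NormedModule)) in hx. subst x.
  intros eps. pose proof (Cmod_ge_0 q). pose proof (cond_pos eps).
  set (K := M * Cmod q ^ 2 + 1).
  assert (hK : 0 < K) by (unfold K; pose proof (pow2_ge_0 (Cmod q)); nra).
  assert (hr : 0 < Rmin (d / (Cmod q + 1)) (eps / K)).
  { apply Rmin_pos; apply Rdiv_lt_0_compat; lra. }
  exists (mkposreal _ hr). intros y hy.
  change (Rabs (y - t) < Rmin (d / (Cmod q + 1)) (eps / K)) in hy.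
  rewrite <- Cmod_norm, scal_R_Cmult.
  change (Cmod (f (p + RtoC y * q) - f (p + t * q) - RtoC (y - t) * (l * q))%C <= eps * Rabs (y - t)).
  apply Rmin_Rgt in hy as [h1 h2].
  assert (hm : Cmod (RtoC (y - t) * q) = Rabs (y - t) * Cmod q) by (rewrite Cmod_mult, Cmod_R; auto).
  pose proof (Rabs_pos (y - t)).
  assert (h3 : Cmod (RtoC (y - t) * q) < d).
  { rewrite hm. apply Rmult_gt_compat_l with (r := Cmod q + 1) in h1; [| lra].
    replace ((Cmod q + 1) * (d / (Cmod q + 1))) with d in h1 by (field; lra). nra. }
  specialize (hf _ h3). rewrite hm in hf.
  replace (p + t * q + RtoC (y - t) * q)%C with (p + RtoC y * q)%C in hf
    by (rewrite RtoC_minus; ring).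
  replace (l * (RtoC (y - t) * q))%C with (RtoC (y - t) * (l * q))%C in hf by ring.
  apply Rle_trans with (1 := hf).
  apply Rmult_gt_compat_l with (r := K) in h2; [| lra].
  replace (K * (eps / K)) with (pos eps) in h2 by (field; lra).
  replace (M * (Rabs (y - t) * Cmod q) ^ 2) with (M * Cmod q ^ 2 * Rabs (y - t) * Rabs (y - t)) by ring.
  apply Rmult_le_compat_r; [lra |]. unfold K in h2. nra.
Qed.

(** * Primitives and integrals along lines *)

Lemma continuous_line (f : C -> C) (p q : C) (t : R) (l : C) :
  qderiv f (p + RtoC t * q)%C l ->
  continuous (U := C_R_NormedModule) (fun s : R => f (p + RtoC s * q)%C) t.
Proof.
  intros hf. apply (ex_derive_continuous (V := C_R_NormedModule)).
  eexists. apply qderiv_line, hf.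
Qed.

Lemma is_RInt_line (G f : C -> C) (p q : C) (x y : R) :
  (forall z, qderiv G z (f z)) -> (forall z, exists l, qderiv f z l) ->
  is_RInt (V := C_R_NormedModule) (fun s => f (p + RtoC s * q)%C * q)%C x y
    (G (p + RtoC y * q)%C - G (p + RtoC x * q)%C)%C.
Proof.
  intros hG hf.
  apply (is_RInt_C_derive (fun s => G (p + RtoC s * q)%C)).
  - intros s. apply qderiv_line, hG.
  - intros s. apply (continuous_ext (fun s => q * f (p + RtoC s * q)%C)%C).
    { intros u. apply Cmult_comm. }
    destruct (hf (p + RtoC s * q)%C) as [l hl].
    apply continuous_C_mult_const, (continuous_line f p q s l hl).
Qed.

Lemma primitive_segment_le (G f : C -> C) (p q : C) (M : R) :
  (forall z, qderiv G z (f z)) -> (forall z, exists l, qderiv f z l) ->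
  (forall s, 0 <= s <= 1 -> Cmod (f (p + RtoC s * (q - p))%C) <= M) ->
  Cmod (G q - G p) <= M * Cmod (q - p).
Proof.
  intros hG hf hM.
  pose proof (is_RInt_line G f p (q - p)%C 0 1 hG hf) as h.
  replace (p + RtoC 1 * (q - p))%C with q in h by ring.
  replace (p + RtoC 0 * (q - p))%C with p in h by ring.
  replace (M * Cmod (q - p)) with ((1 - 0) * (M * Cmod (q - p))) by ring.
  apply RInt_Cmod_le with (3 := h); [lra |].
  intros s hs. rewrite Cmod_mult. apply Rmult_le_compat_r; auto using Cmod_ge_0.
Qed.

(** The integral of [f] over the segment from 0 to [z]; for entire [f] this is a
    primitive, which makes integrals depend on the end points of the path only. *)
Definition radial_primitive (f : C -> C) (z : C) : C :=
  RInt (V := C_R_CompleteNormedModule) (fun u : R => z * f (RtoC u * z))%C 0 1.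

Lemma qderiv_at_scaled (f df : C -> C) (z : C) (u : R) :
  (forall z, qderiv f z (df z)) ->
  is_derive (V := C_R_NormedModule) (fun s : R => f (RtoC s * z)%C) u (df (RtoC u * z) * z)%C.
Proof.
  intros hf.
  apply (is_derive_ext (fun s : R => f (0 + RtoC s * z)%C)).
  { intros s. f_equal. ring. }
  apply qderiv_line. rewrite Cplus_0_l. apply hf.
Qed.

(** The derivative of [z * f (u * z)] in [z] is the derivative of [u * f (u * z)] in
    [u], hence integrates to [f z] over [0, 1].  The locally uniform remainder bound
    on [f] is what allows differentiating under the integral. *)
Lemma qderiv_radial_primitive (f df ddf : C -> C) (z : C) :
  (forall z, qderiv f z (df z)) -> (forall z, qderiv df z (ddf z)) ->
  (forall R, exists M, forall q k, Cmod q <= R -> Cmod k <= 1 ->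
     Cmod (df q) <= M /\ Cmod (f (q + k) - f q - df q * k)%C <= M * Cmod k ^ 2) ->
  qderiv (radial_primitive f) z (f z).
Proof.
  intros hf hdf hM. destruct (hM (Cmod z)) as [M hMz]. clear hM.
  assert (hM0 : 0 <= M).
  { destruct (hMz 0%C 0%C) as [h _]; rewrite ?Cmod_0; try lra; [apply Cmod_ge_0 |].
    apply Rle_trans with (2 := h), Cmod_ge_0. }
  assert (hc : forall z u, continuous (U := C_R_NormedModule) (fun s : R => f (RtoC s * z)%C) u).
  { intros y u. apply (ex_derive_continuous (V := C_R_NormedModule)). eexists.
    apply (qderiv_at_scaled f df), hf. }
  assert (hG : forall z, is_RInt (V := C_R_NormedModule) (fun u : R => z * f (RtoC u * z))%C 0 1
    (radial_primitive f z)).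
  { intros y. apply (RInt_correct (V := C_R_CompleteNormedModule)).
    apply (ex_RInt_continuous (V := C_R_CompleteNormedModule)). intros u _.
    apply continuous_C_mult_const, hc. }
  pose proof (Cmod_ge_0 z) as hz.
  exists ((Cmod z + 1) * M + M), 1. split; [nra |]. split; [lra |]. intros h hh.
  pose proof (Cmod_ge_0 h) as hh0.
  (* The derivative in z of the integrand is an exact derivative in u. *)
  assert (he : is_RInt (V := C_R_NormedModule)
    (fun u : R => h * (f (RtoC u * z) + RtoC u * (df (RtoC u * z) * z)))%C 0 1 (f z * h)%C).
  { rewrite (Cmult_comm (f z)).
    apply is_RInt_C_mult_const with (f := fun u : R =>
      (f (RtoC u * z) + RtoC u * (df (RtoC u * z) * z))%C) (l := f z).
    replace (f z) with (scal (V := C_R_NormedModule) 1 (f (RtoC 1 * z)%C)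
      - scal (V := C_R_NormedModule) 0 (f (RtoC 0 * z)%C))%C.
    2:{ rewrite !scal_R_Cmult, !Cmult_1_l. ring. }
    apply (is_RInt_ext (V := C_R_NormedModule) (fun u : R => plus (scal (V := C_R_NormedModule) 1
      (f (RtoC u * z)%C)) (scal (V := C_R_NormedModule) u (df (RtoC u * z) * z)%C))).
    { intros u _. rewrite !scal_R_Cmult, Cmult_1_l. reflexivity. }
    apply (is_RInt_scal_derive (V := C_R_CompleteNormedModule) (fun u => u)
      (fun u : R => f (RtoC u * z)%C) (fun _ => 1) (fun u : R => (df (RtoC u * z) * z)%C)).
    - intros u _. apply (is_derive_id (K := R_AbsRing)).
    - intros u _. apply qderiv_at_scaled, hf.
    - intros u _. apply continuous_const.
    - intros u _. apply (continuous_ext (fun u : R => z * df (RtoC u * z))%C).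
      { intros v. apply Cmult_comm. }
      apply continuous_C_mult_const, (ex_derive_continuous (V := C_R_NormedModule)).
      eexists. apply (qderiv_at_scaled df ddf), hdf. }
  assert (hd := is_RInt_minus _ _ _ _ _ _ (is_RInt_minus _ _ _ _ _ _ (hG (z + h)%C) (hG z)) he).
  replace (((Cmod z + 1) * M + M) * Cmod h ^ 2) with ((1 - 0) * (((Cmod z + 1) * M + M) * Cmod h ^ 2)) by ring.
  apply RInt_Cmod_le with (3 := hd); [lra |].
  intros u hu.
  change (Cmod ((z + h) * f (RtoC u * (z + h)) - z * f (RtoC u * z)
     - h * (f (RtoC u * z) + RtoC u * (df (RtoC u * z) * z)))%C
     <= ((Cmod z + 1) * M + M) * Cmod h ^ 2).
  assert (hu1 : forall v, Cmod (RtoC u * v) <= Cmod v).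
  { intros v. rewrite Cmod_mult, Cmod_R, Rabs_pos_eq by lra. pose proof (Cmod_ge_0 v). nra. }
  destruct (hMz (RtoC u * z)%C (RtoC u * h)%C) as [m1 m2]; auto.
  { apply Rle_trans with (1 := hu1 h). lra. }
  rewrite Cmult_plus_distr_l.
  match goal with |- Cmod ?e <= _ => replace e with
    ((z + h) * (f (RtoC u * z + RtoC u * h) - f (RtoC u * z) - df (RtoC u * z) * (RtoC u * h))
     + (h * (RtoC u * h)) * df (RtoC u * z))%C by ring end.
  apply Rle_trans with (1 := Cmod_triangle _ _). rewrite !(Cmod_mult _ (_ - _)), !(Cmod_mult (h * _)), (Cmod_mult h).
  pose proof (hu1 h) as huh. pose proof (Cmod_triangle z h).
  assert (Cmod (RtoC u * h) ^ 2 <= Cmod h ^ 2) by (apply pow_incr; split; [apply Cmod_ge_0 | lra]).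
  rewrite Rmult_plus_distr_r. apply Rplus_le_compat.
  - rewrite Rmult_assoc. apply Rmult_le_compat; auto using Cmod_ge_0; [lra |].
    apply Rle_trans with (1 := m2). apply Rmult_le_compat_l; auto.
  - rewrite Rmult_comm. apply Rmult_le_compat; auto using Cmod_ge_0.
    + apply Rmult_le_pos; apply Cmod_ge_0.
    + simpl. rewrite Rmult_1_r. apply Rmult_le_compat_l; auto.
Qed.

(** * Absolutely convergent integrals over the half-line *)

Definition is_int_0_oo {V : NormedModule R_AbsRing} (f : R -> V) (l : V) : Prop :=
  is_RInt_gen f (at_point 0) (Rbar_locally p_infty) l.

Lemma is_int_0_oo_lim {V : CompleteNormedModule R_AbsRing} (f I : R -> V) (l : V) :
  (forall x, 0 <= x -> is_RInt f 0 x (I x)) ->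
  is_int_0_oo f l <-> filterlim I (Rbar_locally p_infty) (locally l).
Proof.
  intros hI. split.
  - intros h P hP. destruct (h P hP) as [Q T hQ [M hT] hQT].
    exists (Rmax M 0). intros x hx.
    assert (M < x) by (apply Rle_lt_trans with (2 := hx), Rmax_l).
    assert (0 < x) by (apply Rle_lt_trans with (2 := hx), Rmax_r).
    destruct (hQT 0 x hQ (hT x H)) as [y [hy hPy]]. simpl in hy.
    assert (y = I x) as <-; auto.
    rewrite <- (is_RInt_unique _ _ _ _ hy). apply is_RInt_unique, hI. lra.
  - intros h P hP. destruct (h P hP) as [M hM].
    exists (fun x => x = 0) (fun x => Rmax M 0 < x).
    + reflexivity.
    + exists (Rmax M 0). auto.
    + intros x y -> hy. exists (I y). split.
      * apply hI, Rlt_le, Rle_lt_trans with (2 := hy), Rmax_r.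
      * apply hM, Rle_lt_trans with (2 := hy), Rmax_l.
Qed.

Lemma is_int_0_oo_unique {V : CompleteNormedModule R_AbsRing} (f : R -> V) (l m : V) :
  is_int_0_oo f l -> is_int_0_oo f m -> l = m.
Proof.
  intros hl hm.
  transitivity (RInt_gen f (at_point 0) (Rbar_locally p_infty)).
  - symmetry. apply is_RInt_gen_unique, hl.
  - apply is_RInt_gen_unique, hm.
Qed.

Lemma is_int_0_oo_ext {V : NormedModule R_AbsRing} (f g : R -> V) (l : V) :
  (forall x, f x = g x) -> is_int_0_oo f l -> is_int_0_oo g l.
Proof. intros h. apply is_RInt_gen_ext, filter_forall. intros; apply h. Qed.

Lemma filterlim_C (I : R -> C) (l : C) :
  filterlim I (Rbar_locally p_infty) (locally (T := C_R_NormedModule) l) <->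
  (forall eps, 0 < eps -> exists M, forall x, M < x -> Cmod (I x - l) < eps).
Proof.
  split.
  - intros h eps heps.
    apply (h (fun y => Cmod (y - l) < eps)).
    apply (locally_le_locally_norm (V := C_R_NormedModule)).
    exists (mkposreal eps heps). intros y hy. unfold ball_norm in hy.
    rewrite <- Cmod_norm in hy. exact hy.
  - intros h P hP.
    apply (locally_norm_le_locally (V := C_R_NormedModule)) in hP.
    destruct hP as [eps hP]. destruct (h eps (cond_pos eps)) as [M hM].
    exists M. intros x hx. apply hP. unfold ball_norm. rewrite <- Cmod_norm. apply hM, hx.
Qed.

(** Every limit at infinity below is reduced to domination by [exp (- s)]; by
    [gauss_decay] this covers all powers times a Gaussian. *)
Lemma exp_decay_lim (f : R -> R) (K : R) :
  (forall s, 0 <= s -> Rabs (f s) <= K * exp (- s)) ->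
  forall eps, 0 < eps -> exists M, 0 <= M /\ forall s, M < s -> Rabs (f s) < eps.
Proof.
  intros hf eps heps.
  assert (hK : 0 <= K).
  { pose proof (hf 0 (Rle_refl 0)) as h. rewrite Ropp_0, exp_0 in h.
    pose proof (Rabs_pos (f 0)). lra. }
  exists (K / eps). split; [apply Rdiv_le_0_compat; lra |]. intros s hs.
  assert (0 <= K / eps) by (apply Rdiv_le_0_compat; lra).
  apply Rle_lt_trans with (1 := hf s ltac:(lra)).
  rewrite exp_Ropp. pose proof (exp_ineq1_le s).
  apply Rmult_lt_reg_r with (exp s); [apply exp_pos |].
  rewrite Rmult_assoc, Rinv_l, Rmult_1_r by (apply Rgt_not_eq, exp_pos).
  apply Rmult_lt_compat_r with (r := eps) in hs; auto.
  replace (K / eps * eps) with K in hs by (field; lra). nra.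
Qed.

Lemma is_int_0_oo_primitive (F f : R -> R) (K : R) :
  (forall s, is_derive F s (f s)) -> (forall s, continuous f s) ->
  (forall s, 0 <= s -> Rabs (F s) <= K * exp (- s)) ->
  is_int_0_oo (V := R_NormedModule) f (- F 0).
Proof.
  intros hF hf hK.
  apply (is_int_0_oo_lim (V := R_CompleteNormedModule) f (fun x => F x - F 0)).
  { intros x _. apply (is_RInt_derive (V := R_CompleteNormedModule) F f); auto. }
  apply filterlim_locally. intros eps.
  destruct (exp_decay_lim F K hK eps (cond_pos eps)) as [M [_ hM]].
  exists M. intros x hx.
  change (Rabs (F x - F 0 - - F 0) < eps).
  replace (F x - F 0 - - F 0) with (F x) by ring. auto.
Qed.

Lemma is_int_0_oo_exp (K : R) :
  is_int_0_oo (V := R_NormedModule) (fun s => K * exp (- s)) K.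
Proof.
  cut (is_int_0_oo (V := R_NormedModule) (fun s => K * exp (- s)) (- (- K * exp (- 0)))).
  { rewrite Ropp_0, exp_0. replace (- (- K * 1)) with K by ring. auto. }
  apply (is_int_0_oo_primitive (fun s => - K * exp (- s)) _ (Rabs K)).
  - intros s. auto_derive; auto; ring.
  - intros s. apply (ex_derive_continuous (V := R_NormedModule)). auto_derive; auto.
  - intros s _. rewrite Rabs_mult, Rabs_Ropp, (Rabs_pos_eq (exp _)) by apply Rlt_le, exp_pos.
    lra.
Qed.

(** From [s ^ k <= exp (k * s)] and completion of the square in the exponent. *)
Lemma gauss_decay (k : nat) (a : R) : 0 < a ->
  exists K, 0 < K /\ forall s, 0 <= s -> s ^ k * exp (- (a * s ^ 2)) <= K * exp (- s).
Proof.
  intros ha. exists (exp ((INR k + 1) ^ 2 / (4 * a))). split; [apply exp_pos |].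
  intros s hs.
  assert (h : s ^ k <= exp (INR k * s)).
  { clear - hs. induction k as [| k IH]; [rewrite Rmult_0_l, exp_0; simpl; lra |].
    rewrite S_INR, Rmult_plus_distr_r, exp_plus, Rmult_1_l. simpl.
    rewrite Rmult_comm. apply Rmult_le_compat; auto; [apply pow_le, hs |].
    pose proof (exp_ineq1_le s). lra. }
  apply Rle_trans with (exp (INR k * s) * exp (- (a * s ^ 2))).
  { apply Rmult_le_compat_r; auto. apply Rlt_le, exp_pos. }
  rewrite <- !exp_plus. apply exp_le.
  apply Rmult_le_reg_l with (4 * a); [lra |].
  replace (4 * a * ((INR k + 1) ^ 2 / (4 * a) + - s)) with ((INR k + 1) ^ 2 - 4 * a * s) by (field; lra).
  pose proof (pow2_ge_0 (INR k + 1 - 2 * a * s)). nra.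
Qed.

(** The constants of the main bounds come from this moment and the fifth one; odd
    moments have elementary primitives. *)
Lemma gauss_moment3 (a : R) : 0 < a ->
  is_int_0_oo (V := R_NormedModule) (fun s => s ^ 3 * exp (- (a * s ^ 2))) (1 / (2 * a ^ 2)).
Proof.
  intros ha.
  destruct (gauss_decay 0 a ha) as (K0 & hK0 & h0).
  destruct (gauss_decay 2 a ha) as (K2 & hK2 & h2).
  set (F := fun s => - ((a * s ^ 2 + 1) / (2 * a ^ 2)) * exp (- (a * s ^ 2))).
  replace (1 / (2 * a ^ 2)) with (- F 0).
  2:{ unfold F. replace (- (a * 0 ^ 2)) with 0 by ring. rewrite exp_0. field. lra. }
  apply (is_int_0_oo_primitive F _ (/ (2 * a) * K2 + / (2 * a ^ 2) * K0)).
  - intros s. unfold F. auto_derive; auto. replace (a * (s * (s * 1))) with (a * s ^ 2) by ring. field. lra.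
  - intros s. apply (ex_derive_continuous (V := R_NormedModule)). auto_derive; auto.
  - intros s hs. specialize (h0 s hs). specialize (h2 s hs). change (s ^ 0) with 1 in h0.
    assert (0 < / (2 * a)) by (apply Rinv_0_lt_compat; lra).
    assert (0 < / (2 * a ^ 2)) by (apply Rinv_0_lt_compat; nra).
    pose proof (exp_pos (- (a * s ^ 2))). pose proof (pow2_ge_0 s).
    unfold F. rewrite <- Rabs_Ropp.
    replace (- (- ((a * s ^ 2 + 1) / (2 * a ^ 2)) * exp (- (a * s ^ 2)))) with
      (/ (2 * a) * (s ^ 2 * exp (- (a * s ^ 2))) + / (2 * a ^ 2) * (1 * exp (- (a * s ^ 2))))
      by (field; lra).
    rewrite Rabs_pos_eq by (apply Rplus_le_le_0_compat; repeat apply Rmult_le_pos; lra).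
    rewrite Rmult_plus_distr_r, !Rmult_assoc.
    apply Rplus_le_compat; apply Rmult_le_compat_l; lra.
Qed.

(** Integration by parts reduces this to the third moment. *)
Lemma gauss_moment5 (a : R) : 0 < a ->
  is_int_0_oo (V := R_NormedModule) (fun s => s ^ 5 * exp (- (a * s ^ 2))) (1 / a ^ 3).
Proof.
  intros ha.
  destruct (gauss_decay 4 a ha) as (K4 & hK4 & h4).
  set (F := fun s => - (s ^ 4 / (2 * a)) * exp (- (a * s ^ 2))).
  replace (1 / a ^ 3) with (- F 0 + 2 / a * (1 / (2 * a ^ 2))) by (unfold F; field; lra).
  apply (is_int_0_oo_ext (fun s => plus (s ^ 5 * exp (- (a * s ^ 2)) - 2 / a * (s ^ 3 * exp (- (a * s ^ 2))))
     (scal (2 / a) (s ^ 3 * exp (- (a * s ^ 2)))))).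
  { intros s. unfold plus, scal; simpl. unfold mult; simpl. ring. }
  apply (is_RInt_gen_plus (V := R_NormedModule)).
  2:{ apply (is_RInt_gen_scal (V := R_NormedModule)), gauss_moment3, ha. }
  apply (is_int_0_oo_primitive F _ (/ (2 * a) * K4)).
  - intros s. unfold F. auto_derive; auto. replace (a * (s * (s * 1))) with (a * s ^ 2) by ring. field. lra.
  - intros s. apply (ex_derive_continuous (V := R_NormedModule)). auto_derive; auto.
  - intros s hs. specialize (h4 s hs).
    assert (0 < / (2 * a)) by (apply Rinv_0_lt_compat; lra).
    pose proof (exp_pos (- (a * s ^ 2))). pose proof (pow_le s 4 hs).
    unfold F. rewrite <- Rabs_Ropp.
    replace (- (- (s ^ 4 / (2 * a)) * exp (- (a * s ^ 2)))) with
      (/ (2 * a) * (s ^ 4 * exp (- (a * s ^ 2)))) by (field; lra).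
    rewrite Rabs_pos_eq by (repeat apply Rmult_le_pos; lra).
    rewrite Rmult_assoc. apply Rmult_le_compat_l; lra.
Qed.

Lemma is_int_0_oo_norm_le (f : R -> C) (g : R -> R) (lf : C) (lg : R) :
  (forall s, 0 <= s -> Cmod (f s) <= g s) ->
  is_int_0_oo (V := C_R_NormedModule) f lf -> is_int_0_oo (V := R_NormedModule) g lg ->
  Cmod lf <= lg.
Proof.
  intros hfg hf hg. rewrite Cmod_norm.
  apply (RInt_gen_norm (V := C_R_CompleteNormedModule) (Fa := at_point 0)
    (Fb := Rbar_locally p_infty) f g lf lg); auto.
  - exists (fun x => x = 0) (fun x => 0 < x); [reflexivity | exists 0; auto |].
    intros x y -> hy. simpl. lra.
  - exists (fun x => x = 0) (fun x => 0 < x); [reflexivity | exists 0; auto |].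
    intros x y -> hy s hs. rewrite <- Cmod_norm. apply hfg. simpl in hs. lra.
Qed.

(** Cauchy's criterion: a tail of the integral of [f] is at most the corresponding
    tail of [K * exp (- s)]. *)
Lemma is_int_0_oo_dominated (f : R -> C) (K : R) :
  (forall s, continuous (U := C_R_NormedModule) f s) ->
  (forall s, 0 <= s -> Cmod (f s) <= K * exp (- s)) ->
  exists l, is_int_0_oo (V := C_R_NormedModule) f l.
Proof.
  intros hc hf.
  assert (hI : forall a b, is_RInt (V := C_R_NormedModule) f a b
    (RInt (V := C_R_CompleteNormedModule) f a b)).
  { intros a b. apply (RInt_correct (V := C_R_CompleteNormedModule)).
    apply (ex_RInt_continuous (V := C_R_CompleteNormedModule)). auto. }
  set (I := RInt (V := C_R_CompleteNormedModule) f 0).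
  destruct (proj1 (filterlim_locally_cauchy (U := C_R_CompleteNormedModule)
    (F := Rbar_locally p_infty) I)) as [l hl].
  2:{ exists l. apply (is_int_0_oo_lim (V := C_R_CompleteNormedModule) f I); auto. }
  intros eps.
  destruct (exp_decay_lim (fun s => K * exp (- s)) (Rabs K)) with (eps := pos eps) as (M & hM0 & hM);
    [| apply cond_pos |].
  { intros s _. rewrite Rabs_mult, (Rabs_pos_eq (exp _)); [lra | apply Rlt_le, exp_pos]. }
  assert (hle : forall u v, M < u -> u <= v -> Cmod (I v - I u) < eps).
  { intros u v hu huv.
    assert (hd : is_RInt (V := C_R_NormedModule) f u v (I v - I u)%C).
    { replace (I v - I u)%C with (plus (opp (I u)) (I v)) by apply Cplus_comm.
      apply (is_RInt_Chasles (V := C_R_NormedModule)) with 0; [| apply hI].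
      apply (is_RInt_swap (V := C_R_NormedModule)), hI. }
    assert (hg : is_RInt (fun s => K * exp (- s)) u v (K * exp (- u) - K * exp (- v))).
    { replace (K * exp (- u) - K * exp (- v)) with (minus (- (K * exp (- v))) (- (K * exp (- u))))
        by (unfold minus, plus, opp; simpl; ring).
      apply (is_RInt_derive (V := R_CompleteNormedModule) (fun s => - (K * exp (- s)))).
      - intros s _. auto_derive; auto; ring.
      - intros s _. apply (ex_derive_continuous (V := R_NormedModule)). auto_derive; auto. }
    rewrite Cmod_norm.
    apply Rle_lt_trans with (K * exp (- u) - K * exp (- v)).
    - apply (norm_RInt_le (V := C_R_NormedModule) f (fun s => K * exp (- s)) u v); auto.
      intros s hs. rewrite <- Cmod_norm. apply hf. lra.
    - specialize (hM u hu). apply Rabs_def2 in hM.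
      assert (0 <= K * exp (- v)); [| lra].
      apply Rle_trans with (2 := hf v ltac:(lra)), Cmod_ge_0. }
  exists (fun x => M < x). split; [exists M; auto |].
  intros u v hu hv.
  apply (norm_compat1 (V := C_R_NormedModule)). rewrite <- Cmod_norm.
  change (Cmod (I v - I u) < eps).
  destruct (Rle_dec u v) as [h | h]; [apply hle; auto |].
  rewrite <- Cmod_opp. replace (- (I v - I u))%C with (I u - I v)%C by ring.
  apply hle; lra.
Qed.

Lemma is_int_0_oo_C_mult_const (f : R -> C) (c l : C) :
  (forall s, continuous (U := C_R_NormedModule) f s) ->
  is_int_0_oo (V := C_R_NormedModule) f l ->
  is_int_0_oo (V := C_R_NormedModule) (fun s => c * f s)%C (c * l)%C.
Proof.
  intros hc hf.
  assert (hI : forall x, is_RInt (V := C_R_NormedModule) f 0 x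
    (RInt (V := C_R_CompleteNormedModule) f 0 x)).
  { intros x. apply (RInt_correct (V := C_R_CompleteNormedModule)).
    apply (ex_RInt_continuous (V := C_R_CompleteNormedModule)). auto. }
  apply (is_int_0_oo_lim (V := C_R_CompleteNormedModule) _
    (fun x => c * RInt (V := C_R_CompleteNormedModule) f 0 x)%C).
  { intros x _. apply is_RInt_C_mult_const, hI. }
  apply (filterlim_comp _ _ _ (RInt (V := C_R_CompleteNormedModule) f 0) (fun u => c * u)%C
    _ (locally (T := C_R_NormedModule) l)).
  - apply (is_int_0_oo_lim (V := C_R_CompleteNormedModule) f); auto.
  - apply (linear_cont (U := C_R_NormedModule) (V := C_R_NormedModule)), is_linear_Cmult.
Qed.

(** * Gaussian-weighted integrals *)

Definition gauss_kernel (a : C) (s : R) : C := Cexp (- (a * (RtoC s * RtoC s))).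

Lemma qderiv_gauss (a u : C) :
  qderiv (fun u => Cexp (- (a * (u * u))))%C u (Cexp (- (a * (u * u))) * (- (a * (u + u))))%C.
Proof.
  eapply qderiv_eq; [qderiv_auto | ring].
Qed.

Lemma continuous_gauss_kernel (a : C) (s : R) :
  continuous (U := C_R_NormedModule) (gauss_kernel a) s.
Proof.
  apply (continuous_ext (fun s : R => (fun u => Cexp (- (a * (u * u))))%C (0 + RtoC s * 1)%C)).
  { intros t. unfold gauss_kernel. rewrite Cplus_0_l, Cmult_1_r. reflexivity. }
  eapply (continuous_line (fun u => Cexp (- (a * (u * u))))%C), qderiv_gauss.
Qed.

Lemma Cmod_gauss_kernel (a : C) (s : R) : Cmod (gauss_kernel a s) = exp (- (Re a * s ^ 2)).
Proof.
  unfold gauss_kernel. rewrite Cmod_Cexp. f_equal.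
  destruct a as [x y]. simpl. ring.
Qed.

Definition gauss_int (h : R -> R) (a : C) : C :=
  RInt_gen (V := C_R_CompleteNormedModule) (fun s => RtoC (h s) * gauss_kernel a s)%C
    (at_point 0) (Rbar_locally p_infty).

Lemma continuous_gauss_integrand (h : R -> R) (a : C) (s : R) :
  (forall s, continuous h s) ->
  continuous (U := C_R_NormedModule) (fun s => RtoC (h s) * gauss_kernel a s)%C s.
Proof.
  intros hh.
  apply (continuous_ext (fun s => scal (V := C_R_NormedModule) (h s) (gauss_kernel a s))).
  { intros t. apply scal_R_Cmult. }
  apply (continuous_scal (V := C_R_NormedModule)); [apply hh | apply continuous_gauss_kernel].
Qed.

Lemma Cmod_gauss_integrand (h : R -> R) (a : C) (s : R) :
  Cmod (RtoC (h s) * gauss_kernel a s) = Rabs (h s) * exp (- (Re a * s ^ 2)).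
Proof. rewrite Cmod_mult, Cmod_R, Cmod_gauss_kernel. reflexivity. Qed.

Lemma gauss_int_correct (h : R -> R) (a : C) (H : R) :
  (forall s, continuous h s) -> (forall s, 0 <= s -> Rabs (h s) <= H * (1 + s ^ 2)) ->
  0 < Re a ->
  is_int_0_oo (V := C_R_NormedModule) (fun s => RtoC (h s) * gauss_kernel a s)%C (gauss_int h a).
Proof.
  intros hc hH ha.
  destruct (gauss_decay 0 (Re a) ha) as (K0 & _ & h0).
  destruct (gauss_decay 2 (Re a) ha) as (K2 & _ & h2).
  apply (RInt_gen_correct (V := C_R_CompleteNormedModule)).
  apply (is_int_0_oo_dominated _ (H * (K0 + K2))).
  - intros s. apply continuous_gauss_integrand, hc.
  - intros s hs. rewrite Cmod_gauss_integrand. specialize (hH s hs).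
    specialize (h0 s hs). specialize (h2 s hs). change (s ^ 0) with 1 in h0.
    pose proof (exp_pos (- (Re a * s ^ 2))). pose proof (pow2_ge_0 s).
    assert (0 <= H).
    { assert (0 <= H * (1 + s ^ 2)) by (apply Rle_trans with (2 := hH), Rabs_pos). nra. }
    apply Rle_trans with (H * (1 + s ^ 2) * exp (- (Re a * s ^ 2))).
    { apply Rmult_le_compat_r; lra. }
    rewrite !Rmult_assoc. apply Rmult_le_compat_l; auto. nra.
Qed.

Lemma gauss_int_unique (h : R -> R) (a l : C) (H : R) :
  (forall s, continuous h s) -> (forall s, 0 <= s -> Rabs (h s) <= H * (1 + s ^ 2)) ->
  0 < Re a ->
  is_int_0_oo (V := C_R_NormedModule) (fun s => RtoC (h s) * gauss_kernel a s)%C l ->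
  gauss_int h a = l.
Proof.
  intros hc hH ha hl.
  apply (is_int_0_oo_unique (V := C_R_CompleteNormedModule) _ _ _
    (gauss_int_correct h a H hc hH ha) hl).
Qed.

Lemma gauss_int_minus (g h : R -> R) (a : C) (G H : R) :
  (forall s, continuous g s) -> (forall s, 0 <= s -> Rabs (g s) <= G * (1 + s ^ 2)) ->
  (forall s, continuous h s) -> (forall s, 0 <= s -> Rabs (h s) <= H * (1 + s ^ 2)) ->
  0 < Re a ->
  gauss_int (fun s => g s - h s) a = (gauss_int g a - gauss_int h a)%C.
Proof.
  intros hg hG hh hH ha.
  apply (gauss_int_unique _ a _ (G + H)); auto.
  - intros s. apply (continuous_minus (V := R_NormedModule)); auto.
  - intros s hs. apply Rle_trans with (1 := Rabs_triang _ _). rewrite Rabs_Ropp.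
    specialize (hG s hs). specialize (hH s hs). lra.
  - apply (is_int_0_oo_ext (fun s => minus (G := C_R_NormedModule)
      (RtoC (g s) * gauss_kernel a s)%C (RtoC (h s) * gauss_kernel a s)%C)).
    { intros s. rewrite RtoC_minus.
      change (RtoC (g s) * gauss_kernel a s - RtoC (h s) * gauss_kernel a s
        = (RtoC (g s) - RtoC (h s)) * gauss_kernel a s)%C. ring. }
    apply (is_RInt_gen_minus (V := C_R_NormedModule)).
    + apply (gauss_int_correct g a G); auto.
    + apply (gauss_int_correct h a H); auto.
Qed.

Lemma Cmod_gauss_int_le (h g : R -> R) (a : C) (H l : R) :
  (forall s, continuous h s) -> (forall s, 0 <= s -> Rabs (h s) <= H * (1 + s ^ 2)) ->
  0 < Re a -> (forall s, 0 <= s -> Rabs (h s) <= g s) ->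
  is_int_0_oo (V := R_NormedModule) (fun s => g s * exp (- (Re a * s ^ 2))) l ->
  Cmod (gauss_int h a) <= l.
Proof.
  intros hc hH ha hg hl.
  apply (is_int_0_oo_norm_le _ _ _ _) with (2 := gauss_int_correct h a H hc hH ha) (3 := hl).
  intros s hs. rewrite Cmod_gauss_integrand.
  apply Rmult_le_compat_r; [apply Rlt_le, exp_pos | auto].
Qed.

(** For [|k| < Re a / 2] the second order remainder of the integrand is at most
    [H |k|^2 s^4 exp (- (Re a / 2) s^2)], which is integrable. *)
Lemma qderiv_gauss_int (h : R -> R) (a : C) (H : R) :
  (forall s, continuous h s) -> (forall s, 0 <= s -> Rabs (h s) <= H) ->
  0 < Re a -> qderiv (gauss_int h) a (- gauss_int (fun s => s ^ 2 * h s)%R a)%C.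
Proof.
  intros hc hH ha.
  assert (hH0 : 0 <= H) by (apply Rle_trans with (2 := hH 0 (Rle_refl 0)), Rabs_pos).
  assert (hc2 : forall s, continuous (fun s => s ^ 2 * h s) s).
  { intros s. apply (continuous_mult (K := R_AbsRing) (fun s => s ^ 2)); auto.
    apply (ex_derive_continuous (V := R_NormedModule)). auto_derive; auto. }
  assert (hH1 : forall s, 0 <= s -> Rabs (h s) <= H * (1 + s ^ 2)).
  { intros s hs. specialize (hH s hs). pose proof (pow2_ge_0 s). nra. }
  assert (hH2 : forall s, 0 <= s -> Rabs (s ^ 2 * h s) <= H * (1 + s ^ 2)).
  { intros s hs. specialize (hH s hs). pose proof (pow2_ge_0 s).
    rewrite Rabs_mult, Rabs_pos_eq by auto. nra. }
  destruct (gauss_decay 4 (Re a / 2)) as (K & hK & h4); [lra |].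
  exists (K * H), (Re a / 2). split; [nra |]. split; [lra |]. intros k hk.
  assert (hak : 0 < Re (a + k)).
  { pose proof (re_le_Cmod k). unfold Re, Cplus in *; simpl.
    pose proof (Rle_abs (- fst k)). rewrite Rabs_Ropp in *. lra. }
  assert (hd : is_int_0_oo (V := C_R_NormedModule)
    (fun s => RtoC (h s) * gauss_kernel (a + k) s - RtoC (h s) * gauss_kernel a s
       + k * (RtoC (s ^ 2 * h s)%R * gauss_kernel a s))%C
    (gauss_int h (a + k) - gauss_int h a - - gauss_int (fun s => s ^ 2 * h s)%R a * k)%C).
  { replace (gauss_int h (a + k) - gauss_int h a - - gauss_int (fun s => s ^ 2 * h s)%R a * k)%C
    with (gauss_int h (a + k) - gauss_int h a + k * gauss_int (fun s => s ^ 2 * h s)%R a)%C by ring.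
    assert (h1 := gauss_int_correct h (a + k)%C H hc hH1 hak).
    assert (h2 := gauss_int_correct h a H hc hH1 ha).
    assert (h3 := gauss_int_correct _ a H hc2 hH2 ha).
    apply (is_int_0_oo_C_mult_const _ k) in h3.
    2:{ intros s. apply (continuous_gauss_integrand _ _ s hc2). }
    exact (is_RInt_gen_plus (V := C_R_NormedModule) _ _ _ _
      (is_RInt_gen_minus (V := C_R_NormedModule) _ _ _ _ h1 h2) h3). }
  apply (is_int_0_oo_norm_le _ _ _ _) with (2 := hd) (3 := is_int_0_oo_exp _).
  intros s hs.
  set (q := (k * (RtoC s * RtoC s))%C).
  assert (hq : Cmod q = Cmod k * s ^ 2).
  { unfold q. rewrite !Cmod_mult, Cmod_R, Rabs_pos_eq by auto. ring. }
  replace (gauss_kernel (a + k) s) with (gauss_kernel a s * Cexp (- q))%C.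
  2:{ unfold gauss_kernel. rewrite <- Cexp_add. f_equal. unfold q. ring. }
  replace (RtoC (h s) * (gauss_kernel a s * Cexp (- q)) - RtoC (h s) * gauss_kernel a s
      + k * (RtoC (s ^ 2 * h s)%R * gauss_kernel a s))%C
    with (RtoC (h s) * gauss_kernel a s * (Cexp (- q) - 1 - - q))%C.
  2:{ unfold q. rewrite RtoC_mult. replace (s ^ 2) with (s * s) by ring. rewrite RtoC_mult. ring. }
  rewrite Cmod_mult, Cmod_gauss_integrand.
  pose proof (Cexp_taylor2 (- q)) as ht. rewrite Cmod_opp, hq in ht.
  specialize (hH s hs). specialize (h4 s hs).
  pose proof (exp_pos (- (Re a * s ^ 2))). pose proof (Cmod_ge_0 k).
  pose proof (pow2_ge_0 s). pose proof (pow2_ge_0 (Cmod k)).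
  apply Rle_trans with (H * exp (- (Re a * s ^ 2)) * ((Cmod k * s ^ 2) ^ 2 * exp (Cmod k * s ^ 2))).
  { apply Rmult_le_compat; auto using Cmod_ge_0.
    - apply Rmult_le_pos; [apply Rabs_pos | lra].
    - apply Rmult_le_compat_r; lra. }
  apply Rle_trans with (H * Cmod k ^ 2 * (s ^ 4 * exp (- (Re a / 2 * s ^ 2)))).
  - replace (H * exp (- (Re a * s ^ 2)) * ((Cmod k * s ^ 2) ^ 2 * exp (Cmod k * s ^ 2)))
      with (H * Cmod k ^ 2 * (s ^ 4 * (exp (- (Re a * s ^ 2)) * exp (Cmod k * s ^ 2)))) by ring.
    apply Rmult_le_compat_l; [nra |]. apply Rmult_le_compat_l; [apply pow_le; auto |].
    rewrite <- exp_plus. apply exp_le. nra.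
  - replace (K * H * Cmod k ^ 2 * exp (- s)) with (H * Cmod k ^ 2 * (K * exp (- s))) by ring.
    apply Rmult_le_compat_l; [nra | exact h4].
Qed.

(** The difference of the two integrands is the derivative of
    [s * exp (- a s^2)], which vanishes at 0 and at infinity. *)
Lemma gauss_int_by_parts (a : C) : 0 < Re a ->
  gauss_int (fun _ => 1) a = (2 * a * gauss_int (fun s => s ^ 2 * 1)%R a)%C.
Proof.
  intros ha.
  assert (hc2 : forall s, continuous (fun s => s ^ 2 * 1) s).
  { intros s. apply (ex_derive_continuous (V := R_NormedModule)). auto_derive; auto. }
  assert (h2 := gauss_int_correct (fun s => s ^ 2 * 1)%R a 1 hc2).
  assert (h1 := gauss_int_correct (fun _ => 1) a 1 (fun _ => continuous_const _ _)).
  cbv beta in h1, h2.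
  assert (h3 : is_int_0_oo (V := C_R_NormedModule)
    (fun s => RtoC 1 * gauss_kernel a s - 2 * a * (RtoC (s ^ 2 * 1)%R * gauss_kernel a s))%C (RtoC 0)).
  { set (G := (fun u => u * Cexp (- (a * (u * u))))%C).
    set (f := (fun u => 1 * Cexp (- (a * (u * u))) + u * (Cexp (- (a * (u * u))) * (- (a * (u + u)))))%C).
    assert (hG : forall u, qderiv G u (f u)).
    { intros u. apply (qderiv_mult (fun u => u) (fun u => Cexp (- (a * (u * u))))%C);
        [apply qderiv_id | apply qderiv_gauss]. }
    assert (hf : forall u, exists l, qderiv f u l).
    { intros u. eexists. unfold f.
      qderiv_auto. }
    assert (hl := fun x y => is_RInt_line G f 0%C 1%C x y hG hf).
    apply (is_int_0_oo_lim (V := C_R_CompleteNormedModule) _ (fun x => G (RtoC x))).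
    - intros x _. specialize (hl 0 x).
      replace (G (0 + RtoC x * 1) - G (0 + RtoC 0 * 1))%C with (G (RtoC x)) in hl.
      2:{ rewrite !Cplus_0_l, !Cmult_1_r. unfold G at 3. ring. }
      apply (is_RInt_ext (V := C_R_NormedModule)) with (2 := hl).
      intros s _. unfold f, gauss_kernel. rewrite !Rmult_1_r, Cplus_0_l, !Cmult_1_r.
      replace (s ^ 2) with (s * s) by ring. rewrite RtoC_mult. match goal with |- ?u = ?v => change (@eq C u v) end. ring.
    - apply filterlim_C. intros eps heps.
      destruct (gauss_decay 1 (Re a) ha) as (K & hK & hd).
      destruct (exp_decay_lim (fun s => s ^ 1 * exp (- (Re a * s ^ 2))) K) with (eps := eps)
        as (M & hM0 & hM); auto.
      { intros s hs. rewrite Rabs_pos_eq; auto. apply Rmult_le_pos; [apply pow_le, hs |].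
        apply Rlt_le, exp_pos. }
      exists M. intros x hx. specialize (hM x hx).
      unfold G. change (Cexp (- (a * (RtoC x * RtoC x)))) with (gauss_kernel a x).
      replace (RtoC x * gauss_kernel a x - 0)%C with (RtoC x * gauss_kernel a x)%C by ring.
      rewrite Cmod_mult, Cmod_R, Cmod_gauss_kernel.
      rewrite Rabs_pos_eq in hM; [rewrite Rabs_pos_eq by lra; simpl in *; lra |].
      apply Rmult_le_pos; [apply pow_le; lra | apply Rlt_le, exp_pos]. }
  set (J := gauss_int (fun _ => 1) a) in *. set (K := gauss_int (fun s => s ^ 2 * 1)%R a) in *.
  assert (h4 : is_int_0_oo (V := C_R_NormedModule)
    (fun s => RtoC 1 * gauss_kernel a s - 2 * a * (RtoC (s ^ 2 * 1)%R * gauss_kernel a s))%C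
    (J - 2 * a * K)%C).
  { apply (is_RInt_gen_minus (V := C_R_NormedModule)).
    - apply h1; auto. intros s _. rewrite Rabs_R1. pose proof (pow2_ge_0 s). lra.
    - apply is_int_0_oo_C_mult_const; [intros s; apply (continuous_gauss_integrand _ _ s hc2) |].
      apply h2; auto. intros s _. pose proof (pow2_ge_0 s). rewrite Rabs_pos_eq; lra. }
  pose proof (is_int_0_oo_unique (V := C_R_CompleteNormedModule) _ _ _ h4 h3) as e.
  replace J with ((J - 2 * a * K) + 2 * a * K)%C by ring.
  rewrite e. ring.
Qed.

(** * The Gaussian integral *)

Definition erf_part (x : R) : R := RInt (fun t => exp (- t ^ 2)) 0 x.

(** The classical companion of [erf_part]: [erf_part x ^ 2 + erf_defect x] has
    derivative zero, equals [atan 1] at 0, and its second term vanishes at infinity. *)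
Definition erf_defect (x : R) : R :=
  RInt (fun t => exp (- (x ^ 2 * (1 + t ^ 2))) / (1 + t ^ 2)) 0 1.

Lemma continuous_exp_sq (t : R) : continuous (fun t => exp (- t ^ 2)) t.
Proof. apply (ex_derive_continuous (V := R_NormedModule)). auto_derive; auto. Qed.

Lemma is_RInt_erf_part (x : R) : is_RInt (fun t => exp (- t ^ 2)) 0 x (erf_part x).
Proof.
  apply (RInt_correct (V := R_CompleteNormedModule)), (ex_RInt_continuous (V := R_CompleteNormedModule)).
  intros; apply continuous_exp_sq.
Qed.

Lemma is_derive_erf_part (x : R) : is_derive erf_part x (exp (- x ^ 2)).
Proof.
  apply (is_derive_RInt (V := R_NormedModule) (fun t => exp (- t ^ 2)) erf_part 0).
  - apply filter_forall. intros y. apply is_RInt_erf_part.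
  - apply continuous_exp_sq.
Qed.

Lemma one_plus_sq_pos (t : R) : 0 < 1 + t ^ 2.
Proof. pose proof (pow2_ge_0 t). lra. Qed.

Lemma is_derive_erf_integrand (x t : R) :
  is_derive (fun x => exp (- (x ^ 2 * (1 + t ^ 2))) / (1 + t ^ 2)) x
    (- 2 * x * exp (- (x ^ 2 * (1 + t ^ 2)))).
Proof.
  pose proof (one_plus_sq_pos t).
  auto_derive; [auto |]. replace (x * (x * 1)) with (x ^ 2) by ring.
  replace (t * (t * 1)) with (t ^ 2) by ring. field. lra.
Qed.

Lemma continuous_erf_integrand (x t : R) :
  continuous (fun t => exp (- (x ^ 2 * (1 + t ^ 2))) / (1 + t ^ 2)) t.
Proof.
  pose proof (one_plus_sq_pos t).
  apply (ex_derive_continuous (V := R_NormedModule)). auto_derive. lra.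
Qed.

Lemma is_RInt_erf_defect (x : R) :
  is_RInt (fun t => exp (- (x ^ 2 * (1 + t ^ 2))) / (1 + t ^ 2)) 0 1 (erf_defect x).
Proof.
  apply (RInt_correct (V := R_CompleteNormedModule)), (ex_RInt_continuous (V := R_CompleteNormedModule)).
  intros; apply continuous_erf_integrand.
Qed.

Lemma is_derive_erf_defect (x : R) :
  is_derive erf_defect x (- 2 * exp (- x ^ 2) * erf_part x).
Proof.
  assert (hD : forall u v, Derive (fun z => exp (- (z ^ 2 * (1 + v ^ 2))) / (1 + v ^ 2)) u
    = - 2 * u * exp (- (u ^ 2 * (1 + v ^ 2)))).
  { intros u v. apply is_derive_unique, is_derive_erf_integrand. }
  replace (- 2 * exp (- x ^ 2) * erf_part x) with
    (RInt (fun t => Derive (fun u => exp (- (u ^ 2 * (1 + t ^ 2))) / (1 + t ^ 2)) x) 0 1).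
  - apply (is_derive_RInt_param (fun x t => exp (- (x ^ 2 * (1 + t ^ 2))) / (1 + t ^ 2))).
    + apply filter_forall. intros y t _. eexists. apply is_derive_erf_integrand.
    + intros t _.
      apply (continuity_2d_pt_ext (fun u v => - 2 * u * exp (- (u ^ 2 * (1 + v ^ 2))))).
      { intros u v. symmetry. apply hD. }
      apply continuity_2d_pt_mult.
      * apply continuity_2d_pt_mult; [apply continuity_2d_pt_const | apply continuity_2d_pt_id1].
      * apply (continuity_1d_2d_pt_comp exp (fun u v => - (u ^ 2 * (1 + v ^ 2)))).
        { apply derivable_continuous_pt, derivable_pt_exp. }
        apply (continuity_2d_pt_ext (fun u v => - (u * u * (1 + v * v)))).
        { intros; ring. }
        apply continuity_2d_pt_opp, continuity_2d_pt_mult;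
          [apply continuity_2d_pt_mult; apply continuity_2d_pt_id1 |].
        apply continuity_2d_pt_plus; [apply continuity_2d_pt_const |].
        apply continuity_2d_pt_mult; apply continuity_2d_pt_id2.
    + apply filter_forall. intros y. eexists. apply is_RInt_erf_defect.
  - apply is_RInt_unique.
    apply (is_RInt_ext (fun t => scal (- 2 * exp (- x ^ 2)) (scal x (exp (- (x * t + 0) ^ 2))))).
    { intros t _. rewrite hD. unfold scal; simpl; unfold mult; simpl.
      replace (- (x * (x * 1) * (1 + t * (t * 1)))) with (- (x * (x * 1)) + - ((x * t + 0) * ((x * t + 0) * 1)))
        by ring. rewrite exp_plus. ring. }
    apply (is_RInt_scal (V := R_NormedModule)).
    apply (is_RInt_comp_lin (V := R_NormedModule) (fun t => exp (- t ^ 2))).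
    replace (x * 0 + 0) with 0 by ring. replace (x * 1 + 0) with x by ring.
    apply is_RInt_erf_part.
Qed.

Lemma erf_identity (x : R) : 0 < x -> erf_part x ^ 2 + erf_defect x = PI / 4.
Proof.
  intros hx.
  set (phi := fun x => erf_part x ^ 2 + erf_defect x).
  transitivity (phi 0).
  - symmetry. apply (eq_is_derive (V := R_NormedModule) phi); [| exact hx].
    intros t _. unfold phi. change (@zero R_NormedModule) with 0.
    replace 0 with (2 * exp (- t ^ 2) * erf_part t + - 2 * exp (- t ^ 2) * erf_part t) by ring.
    apply (is_derive_plus (V := R_NormedModule)); [| apply is_derive_erf_defect].
    apply (is_derive_ext (fun x => erf_part x * erf_part x)); [intros; simpl; ring |].
    replace (2 * exp (- t ^ 2) * erf_part t) with
      (exp (- t ^ 2) * erf_part t + erf_part t * exp (- t ^ 2)) by ring.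
    apply (is_derive_mult (K := R_AbsRing)); try apply is_derive_erf_part. apply Rmult_comm.
  - unfold phi.
    assert (h0 : erf_part 0 = 0) by apply (RInt_point (V := R_CompleteNormedModule)).
    assert (h1 : erf_defect 0 = atan 1 - atan 0).
    { apply is_RInt_unique.
      apply (is_RInt_ext (fun t => / (1 + t ^ 2))).
      { intros t _. replace (- (0 ^ 2 * (1 + t ^ 2))) with 0 by ring. rewrite exp_0.
        match goal with |- ?u = ?v => change (@eq R u v) end. unfold Rdiv. ring. }
      apply (is_RInt_derive (V := R_CompleteNormedModule) atan).
      - intros t _.
        apply is_derive_Reals, derivable_pt_lim_atan.
      - intros t _. pose proof (one_plus_sq_pos t).
        apply (ex_derive_continuous (V := R_NormedModule)). auto_derive. lra. }
    rewrite h0, h1, atan_1, atan_0. simpl. ring.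
Qed.

Lemma erf_defect_bounds (x : R) : 0 <= erf_defect x <= exp (- x ^ 2).
Proof.
  pose proof (is_RInt_erf_defect x) as h. split.
  - apply (is_RInt_ge_0 (fun t => exp (- (x ^ 2 * (1 + t ^ 2))) / (1 + t ^ 2)) 0 1); auto; [lra |].
    intros t _. apply Rlt_le, Rdiv_lt_0_compat; [apply exp_pos | apply one_plus_sq_pos].
  - replace (exp (- x ^ 2)) with ((1 - 0) * exp (- x ^ 2)) by ring.
    apply (is_RInt_le (fun t => exp (- (x ^ 2 * (1 + t ^ 2))) / (1 + t ^ 2)) (fun _ => exp (- x ^ 2))
      0 1 _ _ ltac:(lra) h).
    { apply (is_RInt_const (V := R_NormedModule)). }
    intros t _. pose proof (pow2_ge_0 t). pose proof (pow2_ge_0 x).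
    apply Rle_trans with (exp (- x ^ 2) / 1).
    + apply Rmult_le_compat; [apply Rlt_le, exp_pos | | apply exp_le; nra |].
      * apply Rlt_le, Rinv_0_lt_compat. lra.
      * apply Rinv_le_contravar; lra.
    + lra.
Qed.

Lemma gauss_int_1_1 : gauss_int (fun _ => 1) 1%C = RtoC (sqrt PI / 2).
Proof.
  set (c := sqrt PI / 2).
  assert (hc : 0 < c).
  { unfold c. pose proof (sqrt_lt_R0 PI PI_RGT_0). lra. }
  assert (hc2 : c * c = PI / 4).
  { unfold c. replace (sqrt PI / 2 * (sqrt PI / 2)) with (sqrt PI * sqrt PI / 4) by field.
    rewrite sqrt_sqrt by (pose proof PI_RGT_0; lra). reflexivity. }
  apply (gauss_int_unique _ _ _ 1).
  { intros s. apply continuous_const. }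
  { intros s _. rewrite Rabs_R1. pose proof (pow2_ge_0 s). lra. }
  { simpl. lra. }
  apply (is_int_0_oo_lim (V := C_R_CompleteNormedModule) _ (fun x => RtoC (erf_part x))).
  - intros x _.
    apply (is_RInt_ext (V := C_R_NormedModule) (fun t => (exp (- t ^ 2), 0) : C)).
    { intros t _. unfold gauss_kernel, Cexp, Cmult, Copp, RtoC, Re, Im; simpl.
      replace (- (1 * (t * 0 + 0 * t) + 0 * (t * t - 0 * 0))) with 0 by ring.
      replace (- (1 * (t * t - 0 * 0) - 0 * (t * 0 + 0 * t))) with (- (t * (t * 1))) by ring.
      rewrite cos_0, sin_0. f_equal; ring. }
    apply (is_RInt_fct_extend_pair (U := R_NormedModule) (V := R_NormedModule)).
    + apply is_RInt_erf_part.
    + pose proof (is_RInt_const (V := R_NormedModule) 0 x 0) as h.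
      change (scal (x - 0) 0) with ((x - 0) * 0) in h. rewrite Rmult_0_r in h. exact h.
  - apply filterlim_C. intros eps heps.
    destruct (gauss_decay 0 1 Rlt_0_1) as (K & hK & hd).
    destruct (exp_decay_lim (fun s => exp (- s ^ 2)) K) with (eps := eps * c) as (M & hM0 & hM).
    { intros s hs. specialize (hd s hs). rewrite Rabs_pos_eq by apply Rlt_le, exp_pos.
      change (s ^ 0) with 1 in hd. rewrite !Rmult_1_l in hd. exact hd. }
    { apply Rmult_lt_0_compat; auto. }
    exists M. intros x hx. specialize (hM x hx).
    rewrite <- RtoC_minus, Cmod_R. rewrite Rabs_pos_eq in hM by apply Rlt_le, exp_pos.
    pose proof (erf_identity x ltac:(lra)) as e. pose proof (erf_defect_bounds x).
    assert (h0 : 0 <= erf_part x).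
    { apply (is_RInt_ge_0 (fun t => exp (- t ^ 2)) 0 x); [lra | apply is_RInt_erf_part |].
      intros; apply Rlt_le, exp_pos. }
    assert (h1 : c - erf_part x < eps).
    { apply Rmult_lt_reg_r with c; auto. nra. }
    apply Rabs_def1; [nra | lra].
Qed.

(** The left-hand side has derivative zero in [b] by [gauss_int_by_parts], on a convex
    cone containing 1. *)
Lemma gauss_int_1 (b : C) : 0 < Re b -> 0 < Re (b * b) ->
  (b * gauss_int (fun _ => 1) (b * b))%C = RtoC (sqrt PI / 2).
Proof.
  intros hb hbb. rewrite <- gauss_int_1_1.
  set (J := gauss_int (fun _ => 1)).
  set (Q := fun u : C => (u * J (u * u))%C).
  assert (hQ : forall u, 0 < Re (u * u) -> qderiv Q u 0).
  { intros u hu. unfold Q.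
    assert (hJ : qderiv J (u * u)%C (- gauss_int (fun s => s ^ 2 * 1)%R (u * u))%C).
    { apply (qderiv_gauss_int _ _ 1); auto; intros; [apply continuous_const | rewrite Rabs_R1; lra]. }
    eapply qderiv_eq.
    - apply (qderiv_mult (fun u => u) (fun u => J (u * u))%C); [apply qderiv_id |].
      apply (qderiv_comp J (fun u => u * u)%C); [exact hJ | qderiv_auto].
    - unfold J. rewrite gauss_int_by_parts by auto. ring. }
  transitivity (Q 1%C); [| unfold Q; rewrite !Cmult_1_l; reflexivity].
  transitivity (Q (1 + RtoC 1 * (b - 1))%C); [unfold Q; f_equal; [ring | f_equal; ring] |].
  transitivity (Q (1 + RtoC 0 * (b - 1))%C).
  2:{ f_equal. ring. }
  symmetry.
  apply (eq_is_derive (V := C_R_NormedModule) (fun t : R => Q (1 + RtoC t * (b - 1))%C)); [| lra].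
  intros t ht.
  replace (@zero C_R_NormedModule) with (0 * (b - 1))%C by (rewrite Cmult_0_l; reflexivity).
  apply qderiv_line, hQ. destruct b as [x y]. simpl in *.
  assert (0 <= 2 * t * (1 - t) * x) by (repeat apply Rmult_le_pos; lra).
  assert (0 <= t * t * (x * x - y * y)) by (repeat apply Rmult_le_pos; lra).
  assert (0 < (1 - t) ^ 2 + t * t * (x * x - y * y)).
  { destruct (Req_dec t 1) as [-> | n]; [lra |].
    assert (0 < (1 - t) ^ 2) by (apply pow_lt; lra). lra. }
  match goal with |- 0 < ?e =>
    replace e with ((1 - t) ^ 2 + 2 * t * (1 - t) * x + t * t * (x * x - y * y)) by ring end.
  lra.
Qed.

(** * Steepest descent for the Airy integral *)

Lemma Ci_sq : (Ci * Ci = - (1))%C.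
Proof. unfold Ci, Cmult, Copp, RtoC; simpl; f_equal; ring. Qed.

Lemma RtoC_3_neq_0 : RtoC 3 <> 0%C.
Proof. intros h. apply RtoC_inj in h. lra. Qed.

Lemma qderiv_airy_integrand (w t : C) :
  qderiv (airy_integrand w) t (airy_integrand w t * (t * t - w))%C.
Proof.
  apply (qderiv_ext_loc (fun t => Cexp (/ RtoC 3 * (t * (t * t)) - w * t))%C _ _ _ 1); [lra | |].
  { intros h _. unfold airy_integrand. f_equal. simpl. field. }
  eapply qderiv_eq; [qderiv_auto |].
  unfold airy_integrand. replace (t ^ 3 / RtoC 3 - w * t)%C with (/ RtoC 3 * (t * (t * t)) - w * t)%C
    by (simpl; field).
  field.
Qed.

Lemma Cmod_RtoC3_inv : Cmod (/ RtoC 3) = / 3.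
Proof. rewrite Cmod_inv by exact RtoC_3_neq_0. rewrite Cmod_R, Rabs_pos_eq; lra. Qed.

(** With [p] the cubic exponent and [p (q + k) = p q + d], the remainder equals
    [airy_integrand w q * ((exp d - 1 - d) + e)], where [d] is of first order in [k]
    and its nonlinear part [e] of second order, uniformly on bounded sets. *)
Lemma airy_integrand_remainder (w : C) (R : R) :
  exists M, forall q k, Cmod q <= R -> Cmod k <= 1 ->
    Cmod (airy_integrand w q * (q * q - w)) <= M /\
    Cmod (airy_integrand w (q + k) - airy_integrand w q
          - airy_integrand w q * (q * q - w) * k)%C <= M * Cmod k ^ 2.
Proof.
  set (B := exp (R * R * R + Cmod w * R)).
  set (K := R * R + Cmod w + R + 1).
  exists (B * K + B * (K ^ 2 * exp K + K)). intros q k hq hk.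
  pose proof (Cmod_ge_0 q). pose proof (Cmod_ge_0 k). pose proof (Cmod_ge_0 w).
  assert (hB : Cmod (airy_integrand w q) <= B).
  { unfold airy_integrand. apply Rle_trans with (1 := Cmod_Cexp_le _), exp_le.
    apply Rle_trans with (1 := Cmod_minus_le _ _).
    unfold Cdiv. rewrite !Cmod_mult, Cmod_pow, Cmod_RtoC3_inv.
    assert (Cmod q ^ 3 <= R ^ 3) by (apply pow_incr; lra).
    assert (0 <= Cmod q ^ 3) by (apply pow_le; lra).
    assert (Cmod w * Cmod q <= Cmod w * R) by (apply Rmult_le_compat_l; auto). nra. }
  assert (hB0 : 0 < B) by apply exp_pos.
  assert (hqq : Cmod (q * q) <= R * R) by (rewrite Cmod_mult; nra).
  assert (hqw : Cmod (q * q - w) <= R * R + Cmod w).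
  { apply Rle_trans with (1 := Cmod_minus_le _ _). lra. }
  assert (hK : 1 <= K) by (unfold K; nra).
  pose proof (exp_pos K).
  assert (0 <= K ^ 2 * exp K) by (apply Rmult_le_pos; [apply pow2_ge_0 | lra]).
  split.
  { rewrite Cmod_mult. apply Rle_trans with (B * K).
    - apply Rmult_le_compat; auto using Cmod_ge_0. unfold K; lra.
    - assert (0 <= B * (K ^ 2 * exp K + K)) by (apply Rmult_le_pos; lra). lra. }
  set (e := (k * (k * q) + k * (k * k) * / RtoC 3)%C).
  set (d := (k * (q * q - w) + e)%C).
  assert (he : Cmod e <= (R + 1) * Cmod k ^ 2).
  { unfold e. apply Rle_trans with (1 := Cmod_triangle _ _). rewrite !Cmod_mult, Cmod_RtoC3_inv.
    assert (Cmod k * (Cmod k * Cmod q) <= R * Cmod k ^ 2).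
    { replace (Cmod k * (Cmod k * Cmod q)) with (Cmod q * Cmod k ^ 2) by ring.
      apply Rmult_le_compat_r; [apply pow2_ge_0 | auto]. }
    assert (Cmod k * (Cmod k * Cmod k) <= Cmod k ^ 2).
    { replace (Cmod k ^ 2) with (1 * (Cmod k * Cmod k)) by ring. apply Rmult_le_compat_r; nra. }
    pose proof (pow2_ge_0 (Cmod k)). lra. }
  assert (hd : Cmod d <= K * Cmod k).
  { unfold d. apply Rle_trans with (1 := Cmod_triangle _ _). rewrite Cmod_mult.
    assert (Cmod k ^ 2 <= Cmod k) by (simpl; nra).
    assert ((R + 1) * Cmod k ^ 2 <= (R + 1) * Cmod k) by (apply Rmult_le_compat_l; lra).
    assert (Cmod k * Cmod (q * q - w) <= Cmod k * (R * R + Cmod w)) by (apply Rmult_le_compat_l; auto).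
    unfold K. lra. }
  replace (airy_integrand w (q + k)) with (airy_integrand w q * Cexp d)%C.
  2:{ unfold airy_integrand. rewrite <- Cexp_add. f_equal. unfold d, e. simpl. field.
  }
  replace (airy_integrand w q * Cexp d - airy_integrand w q
          - airy_integrand w q * (q * q - w) * k)%C
    with (airy_integrand w q * ((Cexp d - 1 - d) + e))%C by (unfold d; ring).
  rewrite Cmod_mult.
  assert (hs : Cmod (Cexp d - 1 - d + e) <= (K ^ 2 * exp K + K) * Cmod k ^ 2).
  { apply Rle_trans with (1 := Cmod_triangle _ _).
    pose proof (Cexp_taylor2 d) as ht.
    assert (Cmod d ^ 2 <= (K * Cmod k) ^ 2).
    { apply pow_incr. split; [apply Cmod_ge_0 | auto]. }
    assert (exp (Cmod d) <= exp K) by (apply exp_le; nra).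
    assert (Cmod d ^ 2 * exp (Cmod d) <= (K * Cmod k) ^ 2 * exp K).
    { apply Rmult_le_compat; auto; [apply pow2_ge_0 | apply Rlt_le, exp_pos]. }
    assert ((R + 1) * Cmod k ^ 2 <= K * Cmod k ^ 2).
    { apply Rmult_le_compat_r; [apply pow2_ge_0 | unfold K; nra]. }
    nra. }
  apply Rle_trans with (B * ((K ^ 2 * exp K + K) * Cmod k ^ 2)).
  { apply Rmult_le_compat; auto using Cmod_ge_0. }
  assert (0 <= B * K * Cmod k ^ 2) by (repeat apply Rmult_le_pos; try apply pow2_ge_0; lra).
  lra.
Qed.

Lemma airy_primitive (w : C) :
  exists G, forall t, qderiv G t (airy_integrand w t).
Proof.
  exists (radial_primitive (airy_integrand w)). intros t.
  apply (qderiv_radial_primitive _ (fun t => airy_integrand w t * (t * t - w))%C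
    (fun t => airy_integrand w t * (t * t - w) * (t * t - w) + airy_integrand w t * (t + t))%C).
  - apply qderiv_airy_integrand.
  - intros u. eapply qderiv_eq.
    + apply (qderiv_mult (airy_integrand w)); [apply qderiv_airy_integrand | qderiv_auto].
    + cbv beta. ring.
  - apply airy_integrand_remainder.
Qed.

(** The saddle point [a] of [t ^ 3 / 3 - a ^ 2 t]: along the vertical line through
    it the quadratic term is exactly Gaussian and the cubic one is a pure phase. *)
Lemma airy_integrand_saddle (a : C) (s : R) :
  airy_integrand (a * a) (a + RtoC s * Ci) =
  (Cexp (- (RtoC (2 / 3) * (a * (a * a)))) *
   (RtoC (cos (s ^ 3 / 3)) * gauss_kernel a s - Ci * (RtoC (sin (s ^ 3 / 3)) * gauss_kernel a s)))%C.
Proof.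
  replace (RtoC (cos (s ^ 3 / 3)) * gauss_kernel a s - Ci * (RtoC (sin (s ^ 3 / 3)) * gauss_kernel a s))%C
    with (Cexp (- (Ci * RtoC (s ^ 3 / 3))) * gauss_kernel a s)%C.
  2:{ replace (Cexp (- (Ci * RtoC (s ^ 3 / 3)))) with
        (RtoC (cos (s ^ 3 / 3)) - Ci * RtoC (sin (s ^ 3 / 3)))%C; [ring |].
      set (x := s ^ 3 / 3).
      unfold Cexp, Ci, Cmult, Copp, Cminus, Cplus, RtoC, Re, Im; simpl.
      replace (- (0 * x - 1 * 0)) with 0 by ring. replace (- (0 * 0 + 1 * x)) with (- x) by ring.
      rewrite exp_0, cos_neg, sin_neg. f_equal; ring. }
  unfold airy_integrand, gauss_kernel. rewrite <- !Cexp_add. f_equal.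
  rewrite !RtoC_div by lra. rewrite RtoC_pow.
  assert (h2 : RtoC 2 = (1 + 1)%C) by (rewrite <- RtoC_plus; f_equal; ring).
  assert (h3 : RtoC 3 = (1 + 1 + 1)%C) by (rewrite <- !RtoC_plus; f_equal; ring).
  transitivity (((a ^ 3 + RtoC 3 * a * RtoC s ^ 2 * (Ci * Ci)) / RtoC 3 - a * a * a
    + a * a * RtoC s * Ci - a * a * RtoC s * Ci + RtoC s ^ 3 * Ci * (Ci * Ci) / RtoC 3))%C.
  { simpl. rewrite h3. field. }
  rewrite Ci_sq, h2. simpl. rewrite h3. field.
Qed.

Lemma RtoC_m1 : RtoC (-1) = (- (1))%C.
Proof. rewrite <- RtoC_opp. f_equal. Qed.

Definition airy_cos (a : C) : C := gauss_int (fun s => cos (s ^ 3 / 3)) a.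
Definition airy_sin (a : C) : C := gauss_int (fun s => sin (s ^ 3 / 3)) a.

Lemma gauss_int_bounded_correct (h : R -> R) (a : C) :
  (forall s, continuous h s) -> (forall s, Rabs (h s) <= 1) -> 0 < Re a ->
  is_int_0_oo (V := C_R_NormedModule) (fun s => RtoC (h s) * gauss_kernel a s)%C (gauss_int h a).
Proof.
  intros hc hb ha. apply (gauss_int_correct h a 1); auto.
  intros s _. specialize (hb s). pose proof (pow2_ge_0 s). lra.
Qed.

Lemma continuous_cos_cube (s : R) : continuous (fun s => cos (s ^ 3 / 3)) s.
Proof. apply (ex_derive_continuous (V := R_NormedModule)). auto_derive; auto. Qed.

Lemma continuous_sin_cube (s : R) : continuous (fun s => sin (s ^ 3 / 3)) s.
Proof. apply (ex_derive_continuous (V := R_NormedModule)). auto_derive; auto. Qed.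

Lemma Rabs_cos_le_1 (x : R) : Rabs (cos x) <= 1.
Proof. apply Rabs_le, COS_bound. Qed.

Lemma Rabs_sin_le_1 (x : R) : Rabs (sin x) <= 1.
Proof. apply Rabs_le, SIN_bound. Qed.

Definition saddle_factor (a : C) : C := Cexp (- (RtoC (2 / 3) * (a * (a * a)))).

(** The sign [e] selects the upper or the lower half of the vertical line through
    [a].  The cosine part changes sign with the direction of travel and the sine part
    does not, so only the former survives in the difference of the two halves. *)
Lemma saddle_half_line (a : C) (G : C -> C) (e : R) :
  (e = 1 \/ e = -1) -> 0 < Re a ->
  (forall t, qderiv G t (airy_integrand (a * a) t)) ->
  filterlim (fun y : R => G (a + RtoC y * (RtoC e * Ci))%C) (Rbar_locally p_infty)
    (locally (T := C_R_NormedModule)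
      (G a + saddle_factor a * (RtoC e * Ci * airy_cos a + airy_sin a))%C).
Proof.
  intros he ha hG. apply filterlim_C.
  set (f := fun s : R => (saddle_factor a * (RtoC e * Ci * (RtoC (cos (s ^ 3 / 3)) * gauss_kernel a s)
      + RtoC (sin (s ^ 3 / 3)) * gauss_kernel a s))%C).
  assert (hc : is_int_0_oo (V := C_R_NormedModule) f
    (saddle_factor a * (RtoC e * Ci * airy_cos a + airy_sin a))%C).
  { apply is_int_0_oo_C_mult_const.
    { intros s. apply (continuous_plus (V := C_R_NormedModule)).
      - apply continuous_C_mult_const, (continuous_gauss_integrand (fun s => cos (s ^ 3 / 3))), continuous_cos_cube.
      - apply (continuous_gauss_integrand (fun s => sin (s ^ 3 / 3))), continuous_sin_cube. }
    apply (is_RInt_gen_plus (V := C_R_NormedModule)).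
    - apply is_int_0_oo_C_mult_const.
      { intros s. apply (continuous_gauss_integrand (fun s => cos (s ^ 3 / 3))), continuous_cos_cube. }
      apply (gauss_int_bounded_correct (fun s => cos (s ^ 3 / 3))); auto using continuous_cos_cube, Rabs_cos_le_1.
    - apply (gauss_int_bounded_correct (fun s => sin (s ^ 3 / 3))); auto using continuous_sin_cube, Rabs_sin_le_1. }
  apply (is_int_0_oo_lim (V := C_R_CompleteNormedModule) f
    (fun y => G (a + RtoC y * (RtoC e * Ci)) - G a)%C) in hc.
  - rewrite filterlim_C in hc. intros eps heps. destruct (hc eps heps) as [M hM].
    exists M. intros x hx. specialize (hM x hx).
    match goal with |- Cmod ?u < _ => match type of hM with Cmod ?v < _ =>
      replace u with v by ring end end. exact hM.
  - intros x _.
    replace (G (a + RtoC x * (RtoC e * Ci)) - G a)%C with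
      (G (a + RtoC x * (RtoC e * Ci)) - G (a + RtoC 0 * (RtoC e * Ci)))%C
      by (do 2 f_equal; f_equal; ring).
    apply (is_RInt_ext (V := C_R_NormedModule)) with
      (f := fun s => (airy_integrand (a * a) (a + RtoC s * (RtoC e * Ci)) * (RtoC e * Ci))%C).
    2:{ apply is_RInt_line; auto. intros u. eexists. apply qderiv_airy_integrand. }
    intros s _. unfold f.
    replace (RtoC s * (RtoC e * Ci))%C with (RtoC (s * e) * Ci)%C by (rewrite RtoC_mult; ring).
    rewrite airy_integrand_saddle. fold (saddle_factor a).
    assert (hk : gauss_kernel a (s * e) = gauss_kernel a s).
    { unfold gauss_kernel. do 3 f_equal. rewrite <- !RtoC_mult. f_equal. destruct he as [-> | ->]; ring. }
    rewrite hk.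
    match goal with |- ?u = ?v => change (@eq C u v) end.
    destruct he as [-> | ->].
    + rewrite Rmult_1_r.
      transitivity (saddle_factor a * (RtoC 1 * Ci * (RtoC (cos (s ^ 3 / 3)) * gauss_kernel a s)
        - RtoC 1 * (Ci * Ci) * (RtoC (sin (s ^ 3 / 3)) * gauss_kernel a s)))%C; [ring |].
      rewrite Ci_sq. ring.
    + replace ((s * -1) ^ 3 / 3) with (- (s ^ 3 / 3)) by field. rewrite cos_neg, sin_neg, RtoC_opp.
      transitivity (saddle_factor a * (RtoC (-1) * Ci * (RtoC (cos (s ^ 3 / 3)) * gauss_kernel a s)
        + RtoC (-1) * (Ci * Ci) * (RtoC (sin (s ^ 3 / 3)) * gauss_kernel a s)))%C; [ring |].
      rewrite Ci_sq, RtoC_m1. ring.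
Qed.

(** For [y ^ 2 = 3 * r ^ 2] and [x <= r] one has
    [Re (t ^ 3) = x ^ 3 - 9 * x * r ^ 2 <= - 8 * x * r ^ 2], and [x >= Re a > 0] turns
    this into Gaussian decay in [r], uniformly on the segment. *)
Lemma airy_integrand_between (a : C) (r x y : R) :
  0 < Re a -> Re a <= x <= r -> y ^ 2 = 3 * r ^ 2 ->
  Cmod (airy_integrand (a * a) (x, y)) <=
    exp (- (8 / 3 * Re a * r ^ 2) + 3 * Cmod (a * a) * r).
Proof.
  intros ha hx hy. unfold airy_integrand. rewrite Cmod_Cexp. apply exp_le.
  set (w := (a * a)%C). set (t := ((x, y) : C)).
  assert (h1 : Re (t ^ 3 / RtoC 3 - w * t) = (x ^ 3 - 3 * x * y ^ 2) / 3 - Re (w * t)).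
  { replace (t ^ 3 / RtoC 3)%C with (RtoC (/ 3) * (t * (t * t)))%C
      by (rewrite RtoC_inv by lra; simpl; field).
    unfold t. simpl. field. }
  rewrite h1.
  assert (h2 : - Re (w * t) <= Cmod w * Cmod t).
  { rewrite <- Cmod_mult. pose proof (re_le_Cmod (w * t)). pose proof (Rle_abs (- Re (w * t))).
    rewrite Rabs_Ropp in *. lra. }
  assert (h3 : Cmod t <= 2 * r).
  { apply Rsqr_incr_0_var; [| lra]. rewrite !Rsqr_pow2, Cmod2_alt. unfold t; simpl. simpl in hy. nra. }
  pose proof (Cmod_ge_0 w).
  assert (Cmod w * Cmod t <= Cmod w * (2 * r)) by (apply Rmult_le_compat_l; auto).
  assert (0 <= Cmod w * r) by (apply Rmult_le_pos; lra).
  assert (x ^ 3 <= x * r ^ 2).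
  { replace (x ^ 3) with (x * x ^ 2) by ring. apply Rmult_le_compat_l; [lra |]. apply pow_incr; lra. }
  assert (Re a * r ^ 2 <= x * r ^ 2) by (apply Rmult_le_compat_r; [apply pow2_ge_0 | lra]).
  rewrite hy. nra.
Qed.

Lemma cis_PI_3 (e : R) : (e = 1 \/ e = -1) -> cis (e * (PI / 3)) = (1 / 2, e * (sqrt 3 / 2)).
Proof.
  intros [-> | ->]; unfold cis.
  - rewrite !Rmult_1_l, cos_PI3, sin_PI3. reflexivity.
  - replace (-1 * (PI / 3)) with (- (PI / 3)) by ring.
    rewrite cos_neg, sin_neg, cos_PI3, sin_PI3. f_equal. ring.
Qed.

(** The two points have the same imaginary part, so they are joined by the horizontal
    segment of [airy_integrand_between], whose length is at most [r]. *)
Lemma ray_meets_saddle_line (a : C) (G : C -> C) (e : R) :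
  (e = 1 \/ e = -1) -> 0 < Re a ->
  (forall t, qderiv G t (airy_integrand (a * a) t)) ->
  forall eps, 0 < eps -> exists M, forall s, M < s ->
    Cmod (G (RtoC s * cis (e * (PI / 3)))
      - G (a + RtoC (sqrt 3 * (s / 2) - e * Im a) * (RtoC e * Ci)))%C < eps.
Proof.
  intros he ha hG eps heps.
  set (W := Cmod (a * a)). set (K := exp ((3 * W + 2) ^ 2 / (4 * (8 / 3 * Re a)))).
  assert (hW : 0 <= W) by apply Cmod_ge_0.
  destruct (exp_decay_lim (fun r => K * exp (- r)) (Rabs K)) with (eps := eps) as (M & hM0 & hM); auto.
  { intros s _. rewrite Rabs_mult, (Rabs_pos_eq (exp _)); [lra | apply Rlt_le, exp_pos]. }
  exists (2 * (M + Re a)). intros s hs.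
  set (r := s / 2). assert (hr : M + Re a < r) by (unfold r; lra).
  specialize (hM r ltac:(lra)).
  assert (hs3 : sqrt 3 * sqrt 3 = 3) by (apply sqrt_sqrt; lra).
  set (y := e * (sqrt 3 * r)).
  assert (hy : y ^ 2 = 3 * r ^ 2).
  { unfold y. replace ((e * (sqrt 3 * r)) ^ 2) with (e * e * (sqrt 3 * sqrt 3) * r ^ 2) by ring.
    rewrite hs3. destruct he as [-> | ->]; ring. }
  assert (hq : (RtoC s * cis (e * (PI / 3)))%C = (r, y)).
  { rewrite cis_PI_3 by auto. unfold Cmult, RtoC; simpl. unfold y, r. f_equal; field. }
  assert (hp : (a + RtoC (sqrt 3 * r - e * Im a) * (RtoC e * Ci))%C = (Re a, y)).
  { destruct a as [a1 a2]. unfold Cplus, Cmult, Ci, RtoC, y; simpl.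
    f_equal; [ring |]. destruct he as [-> | ->]; ring. }
  rewrite hq, hp.
  apply Rle_lt_trans with (K * exp (- r)); [| apply Rle_lt_trans with (1 := Rle_abs _); exact hM].
  assert (hl : Cmod ((r, y) - (Re a, y))%C = r - Re a).
  { replace ((r, y) - (Re a, y))%C with (RtoC (r - Re a)).
    - rewrite Cmod_R, Rabs_pos_eq; lra.
    - unfold Cminus, Cplus, Copp, RtoC; simpl. f_equal; ring. }
  set (B := exp (- (8 / 3 * Re a * r ^ 2) + 3 * W * r)).
  apply Rle_trans with (B * (r - Re a)).
  - rewrite <- hl. apply (primitive_segment_le G (airy_integrand (a * a))); auto.
    { intros u. eexists. apply qderiv_airy_integrand. }
    intros u hu.
    replace ((Re a, y) + RtoC u * ((r, y) - (Re a, y)))%C with ((Re a + u * (r - Re a), y) : C).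
    2:{ unfold Cminus, Cplus, Cmult, Copp, RtoC; simpl. f_equal; ring. }
    apply airy_integrand_between; auto. nra.
  - assert (hre : r - Re a <= exp r) by (pose proof (exp_ineq1_le r); lra).
    apply Rle_trans with (B * exp r).
    { apply Rmult_le_compat_l; auto. apply Rlt_le, exp_pos. }
    (* [K] is the maximum of the exponential of [-c r^2 + (3 W + 2) r]. *)
    unfold B, K. rewrite <- !exp_plus. apply exp_le.
    set (c := 8 / 3 * Re a). assert (hc : 0 < c) by (unfold c; lra).
    apply Rmult_le_reg_l with (4 * c); [lra |].
    replace (4 * c * ((3 * W + 2) ^ 2 / (4 * c) + - r)) with ((3 * W + 2) ^ 2 - 4 * c * r) by (field; lra).
    pose proof (pow2_ge_0 (3 * W + 2 - 2 * c * r)). nra.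
Qed.

Lemma airy_ray (a : C) (G : C -> C) (e : R) :
  (e = 1 \/ e = -1) -> 0 < Re a ->
  (forall t, qderiv G t (airy_integrand (a * a) t)) ->
  is_int_0_oo (V := C_R_NormedModule)
    (fun s => airy_integrand (a * a) (RtoC s * cis (e * (PI / 3))) * cis (e * (PI / 3)))%C
    (G a - G 0 + saddle_factor a * (RtoC e * Ci * airy_cos a + airy_sin a))%C.
Proof.
  intros he ha hG. set (u := cis (e * (PI / 3))).
  apply (is_int_0_oo_lim (V := C_R_CompleteNormedModule) _ (fun s => G (RtoC s * u) - G 0)%C).
  { intros x _.
    replace (G (RtoC x * u) - G 0)%C with (G (0 + RtoC x * u) - G (0 + RtoC 0 * u))%C
      by (f_equal; [| f_equal]; f_equal; ring).
    apply (is_RInt_ext (V := C_R_NormedModule)) with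
      (f := fun s => (airy_integrand (a * a) (0 + RtoC s * u) * u)%C).
    { intros s _. rewrite Cplus_0_l. reflexivity. }
    apply is_RInt_line; auto. intros t. eexists. apply qderiv_airy_integrand. }
  apply filterlim_C. intros eps heps.
  pose proof (saddle_half_line a G e he ha hG) as hv. rewrite filterlim_C in hv.
  destruct (hv (eps / 2)) as [M1 h1]; [lra |].
  destruct (ray_meets_saddle_line a G e he ha hG (eps / 2)) as [M2 h2]; [lra |].
  exists (Rmax M2 (2 * (Rabs M1 + Rabs (Im a)))). intros s hs.
  assert (hs1 : M2 < s) by (apply Rle_lt_trans with (2 := hs), Rmax_l).
  assert (hs2 : 2 * (Rabs M1 + Rabs (Im a)) < s) by (apply Rle_lt_trans with (2 := hs), Rmax_r).
  specialize (h2 s hs1). set (y := sqrt 3 * (s / 2) - e * Im a) in *.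
  assert (hy : M1 < y).
  { pose proof (Rle_abs M1). pose proof (Rabs_pos M1). pose proof (Rabs_pos (Im a)).
    assert (e * Im a <= Rabs (Im a)).
    { pose proof (Rle_abs (Im a)). pose proof (Rle_abs (- Im a)). rewrite Rabs_Ropp in *.
      destruct he as [-> | ->]; lra. }
    assert (1 <= sqrt 3) by (rewrite <- sqrt_1; apply sqrt_le_1; lra).
    unfold y. nra. }
  specialize (h1 y hy). unfold u.
  match goal with |- Cmod ?d < _ => match type of h1 with Cmod ?d1 < _ =>
    match type of h2 with Cmod ?d2 < _ => replace d with (d1 + d2)%C by ring end end end.
  apply Rle_lt_trans with (1 := Cmod_triangle _ _). lra.
Qed.

(** The rotation leaves [t ^ 3] alone and turns the contour into one that is symmetric
    about the real axis. *)
Lemma airy_integrand_rotate (z t : C) :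
  airy_integrand z (cis (- (2 * PI / 3)) * t) = airy_integrand (z * cis (- (2 * PI / 3))) t.
Proof.
  unfold airy_integrand. f_equal.
  assert (h : (cis (- (2 * PI / 3)) ^ 3)%C = 1%C).
  { simpl. rewrite Cmult_1_r, <- !cis_add.
    replace (- (2 * PI / 3) + (- (2 * PI / 3) + - (2 * PI / 3))) with (- (2 * PI)) by field.
    unfold cis. rewrite cos_neg, sin_neg, cos_2PI, sin_2PI, Ropp_0. reflexivity. }
  transitivity (cis (- (2 * PI / 3)) ^ 3 * t ^ 3 / RtoC 3 - z * cis (- (2 * PI / 3)) * t)%C.
  { simpl. field. }
  rewrite h, Cmult_1_l. reflexivity.
Qed.

Lemma ray_int_rotate (z : C) (theta : R) (l : C) :
  is_int_0_oo (V := C_R_NormedModule)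
    (fun s => airy_integrand (z * cis (- (2 * PI / 3))) (RtoC s * cis theta) * cis theta)%C l ->
  ray_int (airy_integrand z) (theta - 2 * PI / 3) = (cis (- (2 * PI / 3)) * l)%C.
Proof.
  intros h. unfold ray_int.
  refine (is_RInt_gen_unique (V := C_R_CompleteNormedModule) _ _ _).
  apply (is_int_0_oo_C_mult_const _ (cis (- (2 * PI / 3)))) in h.
  - apply (is_int_0_oo_ext) with (2 := h). intros s.
    unfold Rminus. rewrite (Rplus_comm theta), cis_add.
    replace (RtoC s * (cis (- (2 * PI / 3)) * cis theta))%C
      with (cis (- (2 * PI / 3)) * (RtoC s * cis theta))%C by ring.
    rewrite airy_integrand_rotate. 
    match goal with |- ?u = ?v => change (@eq C u v) end. ring.
  - intros s.
    apply (continuous_ext (fun s : R => cis theta *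
      airy_integrand (z * cis (- (2 * PI / 3))) (0 + RtoC s * cis theta))%C).
    { intros x. rewrite Cplus_0_l. apply Cmult_comm. }
    apply continuous_C_mult_const.
    eapply (continuous_line (airy_integrand _)), qderiv_airy_integrand.
Qed.

Lemma airyA_saddle (z a : C) :
  0 < Re a -> (a * a)%C = (z * cis (- (2 * PI / 3)))%C ->
  airyA z = (/ RtoC (sqrt PI) * cis (- (2 * PI / 3)) * (RtoC 2 * Ci * saddle_factor a * airy_cos a))%C.
Proof.
  intros ha hw. destruct (airy_primitive (a * a)) as [G hG].
  pose proof (airy_ray a G 1 (or_introl eq_refl) ha hG) as h1.
  pose proof (airy_ray a G (-1) (or_intror eq_refl) ha hG) as h2.
  rewrite airyA_contour. unfold contour_int.
  rewrite hw in h1, h2. apply ray_int_rotate in h1, h2.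
  replace (1 * (PI / 3) - 2 * PI / 3) with (- (PI / 3)) in h1 by field.
  assert (hc : ray_int (airy_integrand z) PI = ray_int (airy_integrand z) (-1 * (PI / 3) - 2 * PI / 3)).
  { unfold ray_int. replace (cis (-1 * (PI / 3) - 2 * PI / 3)) with (cis PI); [reflexivity |].
    unfold cis. replace (-1 * (PI / 3) - 2 * PI / 3) with (- PI) by field.
    rewrite cos_neg, sin_neg, sin_PI, Ropp_0. reflexivity. }
  rewrite hc, h1, h2. rewrite RtoC_m1.
  assert (e2 : RtoC 2 = (1 + 1)%C) by (rewrite <- RtoC_plus; f_equal; ring).
  rewrite e2. ring.
Qed.

(** * The rotated fourth root *)

(** A square root with values in a half-plane is automatically continuous:
    [|S' - S| * |S' + S| = |u' - u|], and [|S' + S|] is at least [Re S].  The quadratic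
    remainder then follows from [u' - u = 2 * S * (S' - S) + (S' - S) ^ 2].  This gives
    the derivative of the fourth root without differentiating the argument function,
    and shows that points near [z] are off the cut as well. *)
Lemma qderiv_sqrt (S u : C -> C) (z l : C) (r : R) :
  0 < r -> (forall h, Cmod h < r -> (S (z + h) * S (z + h))%C = u (z + h)%C /\ 0 <= Re (S (z + h)%C)) ->
  0 < Re (S z) -> qderiv u z l -> qderiv S z (l / (RtoC 2 * S z))%C.
Proof.
  intros hr hS hc hu.
  destruct (qderiv_lipschitz _ _ _ hu) as (K & d1 & hK & hd1 & h1).
  destruct hu as (M & d2 & hM & hd2 & h2).
  set (c := Re (S z)) in *.
  assert (hc2 : c <= Cmod (S z)) by apply Re_le_Cmod.
  assert (hSz : S z <> 0%C) by (apply Cmod_gt_0; lra).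
  assert (h20 : RtoC 2 <> 0%C) by (intros h; apply RtoC_inj in h; lra).
  exists ((M + K ^ 2 / c ^ 2) / c), (Rmin r (Rmin d1 d2)).
  assert (0 <= K ^ 2 / c ^ 2) by (apply Rdiv_le_0_compat; [apply pow2_ge_0 | apply pow_lt; lra]).
  split; [apply Rdiv_le_0_compat; lra |].
  split; [repeat apply Rmin_pos; auto |].
  intros h hh. apply Rmin_Rgt in hh as [e0 hh]. apply Rmin_Rgt in hh as [e1 e2].
  specialize (h1 h e1). specialize (h2 h e2).
  destruct (hS h e0) as [hs hs0].
  assert (hz : (S z * S z)%C = u z).
  { destruct (hS 0%C) as [hs' _]; [rewrite Cmod_0; auto |]. rewrite Cplus_0_r in hs'. auto. }
  set (s := S (z + h)%C) in *. rewrite <- hs, <- hz in h1, h2.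
  assert (hsum : c <= Cmod (s + S z)).
  { apply Rle_trans with (2 := Re_le_Cmod _). unfold c in *. unfold Re, Cplus in *; simpl. lra. }
  assert (hdiff : Cmod (s - S z) <= K * Cmod h / c).
  { apply Rmult_le_reg_r with c; auto.
    replace (K * Cmod h / c * c) with (K * Cmod h) by (field; lra).
    apply Rle_trans with (2 := h1).
    replace (s * s - S z * S z)%C with ((s - S z) * (s + S z))%C by ring.
    rewrite Cmod_mult. apply Rmult_le_compat_l; auto using Cmod_ge_0. }
  replace (s - S z - l / (RtoC 2 * S z) * h)%C with
    ((s * s - S z * S z - l * h - (s - S z) * (s - S z)) / (RtoC 2 * S z))%C
    by (field; auto).
  rewrite Cmod_div by (apply Cmult_neq_0; auto).
  rewrite Cmod_mult, (Cmod_R 2), Rabs_pos_eq by lra.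
  apply Rle_trans with ((M + K ^ 2 / c ^ 2) * Cmod h ^ 2 / c).
  2:{ right. field. lra. }
  apply Rmult_le_compat; [apply Cmod_ge_0 | apply Rlt_le, Rinv_0_lt_compat; lra | |
    apply Rinv_le_contravar; lra].
  apply Rle_trans with (1 := Cmod_minus_le _ _). rewrite Rmult_plus_distr_r.
  apply Rplus_le_compat; auto.
  rewrite Cmod_mult.
  replace (K ^ 2 / c ^ 2 * Cmod h ^ 2) with ((K * Cmod h / c) * (K * Cmod h / c)) by (field; lra).
  apply Rmult_le_compat; auto using Cmod_ge_0.
Qed.

Definition root_angle (z : C) : R := arg_cut z - 2 * PI / 3.

(** The principal fourth root of [z * cis (- (2 * PI / 3))]. *)
Definition airy_root (z : C) : C :=
  (RtoC (Rpower (Cmod z) (1 / 4)) * cis (root_angle z / 4))%C.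

Lemma root_angle_bound (z : C) : z <> 0%C -> - PI < root_angle z <= PI.
Proof. intros hz. destruct (arg_cut_spec z hz) as [h _]. unfold root_angle. lra. Qed.

Lemma Re_real_cis (r t : R) : Re (RtoC r * cis t) = r * cos t.
Proof. unfold cis, RtoC; simpl. ring. Qed.

Lemma airy_root_sq (z : C) :
  (airy_root z * airy_root z)%C = (RtoC (Rpower (Cmod z) (1 / 2)) * cis (root_angle z / 2))%C.
Proof.
  unfold airy_root.
  replace (root_angle z / 2) with (root_angle z / 4 + root_angle z / 4) by field.
  replace (1 / 2) with (1 / 4 + 1 / 4) by field.
  rewrite cis_add, Rpower_plus, RtoC_mult. ring.
Qed.

Lemma airy_root_pow4 (z : C) : z <> 0%C ->
  let a := (airy_root z * airy_root z)%C in (a * a)%C = (z * cis (- (2 * PI / 3)))%C.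
Proof.
  intros hz a. unfold a. rewrite airy_root_sq.
  assert (hm : 0 < Cmod z) by (apply Cmod_gt_0, hz).
  destruct (arg_cut_spec z hz) as [_ ha]. unfold is_arg in ha.
  transitivity (RtoC (Cmod z) * (cis (arg_cut z) * cis (- (2 * PI / 3))))%C.
  2:{ rewrite Cmult_assoc, <- ha. reflexivity. }
  rewrite <- cis_add.
  replace (arg_cut z + - (2 * PI / 3)) with (root_angle z / 2 + root_angle z / 2)
    by (unfold root_angle; field).
  rewrite cis_add.
  assert (hr : Cmod z = Rpower (Cmod z) (1 / 2) * Rpower (Cmod z) (1 / 2)).
  { rewrite <- Rpower_plus. replace (1 / 2 + 1 / 2) with 1 by field. symmetry. apply Rpower_1, hm. }
  transitivity (RtoC (Rpower (Cmod z) (1 / 2) * Rpower (Cmod z) (1 / 2)) *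
    (cis (root_angle z / 2) * cis (root_angle z / 2)))%C; [rewrite RtoC_mult; ring |].
  rewrite <- hr. reflexivity.
Qed.

Lemma Re_airy_root_pos (z : C) : z <> 0%C -> 0 < Re (airy_root z).
Proof.
  intros hz. pose proof (root_angle_bound z hz). unfold airy_root. rewrite Re_real_cis.
  apply Rmult_lt_0_compat; [apply exp_pos |]. pose proof PI_RGT_0. apply cos_gt_0; lra.
Qed.

Lemma Re_airy_root_sq_ge_0 (z : C) : z <> 0%C -> 0 <= Re (airy_root z * airy_root z).
Proof.
  intros hz. pose proof (root_angle_bound z hz). rewrite airy_root_sq, Re_real_cis.
  apply Rmult_le_pos; [apply Rlt_le, exp_pos |]. apply cos_ge_0; lra.
Qed.

Lemma Cmod_airy_root (z : C) : Cmod (airy_root z) = Rpower (Cmod z) (1 / 4).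
Proof.
  unfold airy_root. rewrite Cmod_mult, Cmod_cis, Cmod_R, Rabs_pos_eq by apply Rlt_le, exp_pos. ring.
Qed.

Lemma nonzero_nearby (z h : C) : Cmod h < Cmod z -> (z + h)%C <> 0%C.
Proof.
  intros hh e. replace h with (- z)%C in hh; [rewrite Cmod_opp in hh; lra |].
  replace h with ((z + h) - z)%C by ring. rewrite e. ring.
Qed.

Lemma qderiv_airy_root_sq (z : C) : z <> 0%C -> 0 < Re (airy_root z * airy_root z) ->
  qderiv (fun w => airy_root w * airy_root w)%C z
    (cis (- (2 * PI / 3)) / (RtoC 2 * (airy_root z * airy_root z)))%C.
Proof.
  intros hz ha.
  apply (qderiv_sqrt (fun w => airy_root w * airy_root w)%C (fun w => w * cis (- (2 * PI / 3)))%C z _ (Cmod z)).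
  - apply Cmod_gt_0, hz.
  - intros h hh. pose proof (nonzero_nearby z h hh) as hn.
    split; [apply (airy_root_pow4 (z + h)), hn | apply Re_airy_root_sq_ge_0, hn].
  - exact ha.
  - eapply qderiv_eq; [qderiv_auto | ring].
Qed.

Lemma qderiv_airy_root (z : C) : z <> 0%C -> 0 < Re (airy_root z * airy_root z) ->
  qderiv airy_root z
    (cis (- (2 * PI / 3)) / (RtoC 2 * (airy_root z * airy_root z)) / (RtoC 2 * airy_root z))%C.
Proof.
  intros hz ha.
  apply (qderiv_sqrt airy_root (fun w => airy_root w * airy_root w)%C z _ (Cmod z)).
  - apply Cmod_gt_0, hz.
  - intros h hh. split; [reflexivity |]. apply Rlt_le, Re_airy_root_pos, nonzero_nearby, hh.
  - apply Re_airy_root_pos, hz.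
  - apply qderiv_airy_root_sq; auto.
Qed.

(** * The quotient by the WKB wave function *)

Lemma Cpowr_polar (z : C) (p : R) : Cpowr z p = (RtoC (Rpower (Cmod z) p) * cis (p * arg_cut z))%C.
Proof.
  unfold Cpowr, Clog, Cexp, Rpower, cis, Cmult, RtoC, Re, Im; simpl.
  replace (p * ln (Cmod z) - 0 * arg_cut z) with (p * ln (Cmod z)) by ring.
  replace (p * arg_cut z + 0 * ln (Cmod z)) with (p * arg_cut z) by ring.
  f_equal; ring.
Qed.

Lemma Cpowr_3_2_airy_root (z : C) :
  let a := (airy_root z * airy_root z)%C in Cpowr z (3 / 2) = (- (a * (a * a)))%C.
Proof.
  intros a. unfold a. rewrite airy_root_sq, Cpowr_polar.
  replace (3 / 2 * arg_cut z) with (root_angle z / 2 + (root_angle z / 2 + root_angle z / 2) + PI)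
    by (unfold root_angle; field).
  replace (Rpower (Cmod z) (3 / 2)) with (Rpower (Cmod z) (1 / 2 + (1 / 2 + 1 / 2))) by (f_equal; field).
  rewrite !cis_add, !Rpower_plus, !RtoC_mult.
  replace (cis PI) with (- (1))%C; [ring |].
  unfold cis. rewrite cos_PI, sin_PI. unfold Copp, RtoC; simpl. f_equal; ring.
Qed.

Lemma Cpowr_quarter_airy_root (z : C) :
  (airy_root z * Cpowr z (- (1 / 4)))%C = (cis (- (2 * PI / 3)) * Ci)%C.
Proof.
  replace Ci with (cis (PI / 2)) by (unfold cis; rewrite cos_PI2, sin_PI2; reflexivity).
  rewrite Cpowr_polar. unfold airy_root.
  replace (RtoC (Rpower (Cmod z) (1 / 4)) * cis (root_angle z / 4) *
    (RtoC (Rpower (Cmod z) (- (1 / 4))) * cis (- (1 / 4) * arg_cut z)))%C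
    with (RtoC (Rpower (Cmod z) (1 / 4) * Rpower (Cmod z) (- (1 / 4))) *
      (cis (root_angle z / 4) * cis (- (1 / 4) * arg_cut z)))%C by (rewrite RtoC_mult; ring).
  rewrite <- Rpower_plus, <- !cis_add.
  replace (1 / 4 + - (1 / 4)) with 0 by ring.
  unfold Rpower. rewrite Rmult_0_l, exp_0, Cmult_1_l. f_equal. unfold root_angle. field.
Qed.

(** The relative error of the WKB approximation, up to the factor
    [2 / sqrt PI * airy_root z], with [a] the square of the root. *)
Definition wkb_defect (a : C) : C := gauss_int (fun s => cos (s ^ 3 / 3) - 1) a.

Lemma continuous_cos_cube_m1 (s : R) : continuous (fun s => cos (s ^ 3 / 3) - 1) s.
Proof. apply (ex_derive_continuous (V := R_NormedModule)). auto_derive; auto. Qed.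

Lemma airyA_quotient (z : C) : z <> 0%C -> 0 < Re (airy_root z * airy_root z) ->
  (airyA z / airyA_WKB z)%C =
  (1 + RtoC (2 / sqrt PI) * (airy_root z * wkb_defect (airy_root z * airy_root z)))%C.
Proof.
  intros hz ha. set (b := airy_root z) in *. set (a := (b * b)%C) in *.
  assert (hb : 0 < Re b) by (apply Re_airy_root_pos, hz).
  assert (hb0 : b <> 0%C).
  { apply Cmod_gt_0. apply Rlt_le_trans with (1 := hb), Re_le_Cmod. }
  assert (hpi : 0 < sqrt PI) by (apply sqrt_lt_R0, PI_RGT_0).
  assert (hpiC : RtoC (sqrt PI) <> 0%C) by (intros h; apply RtoC_inj in h; lra).
  assert (hD : wkb_defect a = (airy_cos a - gauss_int (fun _ => 1) a)%C).
  { apply (gauss_int_minus (fun s => cos (s ^ 3 / 3)) (fun _ => 1) a 1 1); auto.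
    - apply continuous_cos_cube.
    - intros s _. pose proof (Rabs_cos_le_1 (s ^ 3 / 3)). pose proof (pow2_ge_0 s). lra.
    - intros s. apply continuous_const.
    - intros s _. rewrite Rabs_R1. pose proof (pow2_ge_0 s). lra. }
  assert (hJ : (b * gauss_int (fun _ => 1) a)%C = RtoC (sqrt PI / 2)) by (apply gauss_int_1; auto).
  transitivity (RtoC (2 / sqrt PI) * (b * airy_cos a))%C.
  2:{ rewrite hD. replace (b * (airy_cos a - gauss_int (fun _ => 1) a))%C
        with (b * airy_cos a - b * gauss_int (fun _ => 1) a)%C by ring.
      rewrite hJ, !RtoC_div by lra. field. auto. }
  rewrite (airyA_saddle z a ha (airy_root_pow4 z hz)).
  unfold airyA_WKB. rewrite Cpowr_3_2_airy_root. fold b a.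
  pose proof (Cpowr_quarter_airy_root z) as hq. fold b in hq.
  set (p := Cpowr z (- (1 / 4))) in *.
  assert (hs : (RtoC (2 / 3) * - (a * (a * a)) = - (RtoC (2 / 3) * (a * (a * a))))%C) by ring.
  rewrite hs. fold (saddle_factor a).
  assert (hf : saddle_factor a <> 0%C).
  { apply Cmod_gt_0. unfold saddle_factor. rewrite Cmod_Cexp. apply exp_pos. }
  assert (hp : p <> 0%C).
  { intros e. rewrite e, Cmult_0_r in hq.
    assert (h : Cmod (cis (- (2 * PI / 3)) * Ci) = 0) by (rewrite <- hq; apply Cmod_0).
    rewrite Cmod_mult, Cmod_cis, Cmod_Ci in h. lra. }
  replace (/ RtoC (sqrt PI) * cis (- (2 * PI / 3)) * (RtoC 2 * Ci * saddle_factor a * airy_cos a))%C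
    with (/ RtoC (sqrt PI) * RtoC 2 * saddle_factor a * airy_cos a * (cis (- (2 * PI / 3)) * Ci))%C by ring.
  rewrite <- hq, RtoC_div by lra. field. auto.
Qed.

Lemma Rabs_cos_m1_le (x : R) : Rabs (cos x - 1) <= Rabs x.
Proof.
  pose proof (bounded_variation cos (fun x => - sin x) 1 0 x) as h.
  rewrite cos_0, Rminus_0_r, Rmult_1_l in h. apply h.
  intros t _. split; [auto_derive; auto; ring |]. rewrite Rabs_Ropp. apply Rabs_sin_le_1.
Qed.

Lemma Rabs_cos_cube_m1_le (s : R) : 0 <= s -> Rabs (cos (s ^ 3 / 3) - 1) <= / 3 * s ^ 3.
Proof.
  intros hs. pose proof (pow_le s 3 hs).
  apply Rle_trans with (1 := Rabs_cos_m1_le _). rewrite Rabs_pos_eq; lra.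
Qed.

Lemma Rabs_cos_m1_le_2 (x : R) : Rabs (cos x - 1) <= 2.
Proof. pose proof (COS_bound x). apply Rabs_le. lra. Qed.

Lemma Cmod_wkb_defect_le (a : C) : 0 < Re a -> Cmod (wkb_defect a) <= / (6 * Re a ^ 2).
Proof.
  intros ha.
  apply (Cmod_gauss_int_le _ (fun s => / 3 * s ^ 3) a 2); auto using continuous_cos_cube_m1, Rabs_cos_cube_m1_le.
  - intros s _. pose proof (Rabs_cos_m1_le_2 (s ^ 3 / 3)). pose proof (pow2_ge_0 s). lra.
  - replace (/ (6 * Re a ^ 2)) with (/ 3 * (1 / (2 * Re a ^ 2))) by (field; lra).
    apply (is_int_0_oo_ext (fun s => scal (/ 3) (s ^ 3 * exp (- (Re a * s ^ 2))))).
    { intros s. unfold scal; simpl; unfold mult; simpl. ring. }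
    apply (is_RInt_gen_scal (V := R_NormedModule)), gauss_moment3, ha.
Qed.

Lemma qderiv_wkb_defect (a : C) : 0 < Re a ->
  exists l, qderiv wkb_defect a l /\ Cmod l <= / (3 * Re a ^ 3).
Proof.
  intros ha. eexists. split.
  { apply (qderiv_gauss_int _ a 2); auto using continuous_cos_cube_m1.
    intros s _. apply Rabs_cos_m1_le_2. }
  rewrite Cmod_opp.
  apply (Cmod_gauss_int_le _ (fun s => / 3 * s ^ 5) a 2); auto.
  - intros s. apply (ex_derive_continuous (V := R_NormedModule)). auto_derive; auto.
  - intros s _. pose proof (Rabs_cos_m1_le_2 (s ^ 3 / 3)). pose proof (pow2_ge_0 s).
    rewrite Rabs_mult, Rabs_pos_eq by auto. nra.
  - intros s hs. pose proof (Rabs_cos_cube_m1_le s hs). pose proof (pow2_ge_0 s).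
    rewrite Rabs_mult, Rabs_pos_eq by auto.
    replace (/ 3 * s ^ 5) with (s ^ 2 * (/ 3 * s ^ 3)) by ring. apply Rmult_le_compat_l; auto.
  - replace (/ (3 * Re a ^ 3)) with (/ 3 * (1 / Re a ^ 3)) by (field; lra).
    apply (is_int_0_oo_ext (fun s => scal (/ 3) (s ^ 5 * exp (- (Re a * s ^ 2))))).
    { intros s. unfold scal; simpl; unfold mult; simpl. ring. }
    apply (is_RInt_gen_scal (V := R_NormedModule)), gauss_moment5, ha.
Qed.

Lemma two_div_sqrt_PI_bound : 0 < 2 / sqrt PI <= 2.
Proof.
  assert (h : 1 <= sqrt PI).
  { rewrite <- sqrt_1 at 1. apply sqrt_le_1; try lra; pose proof PI2_1; lra. }
  split; [apply Rdiv_lt_0_compat; lra |].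
  apply Rmult_le_reg_r with (sqrt PI); [lra |].
  replace (2 / sqrt PI * sqrt PI) with 2 by (field; lra). lra.
Qed.

(** The chain rule applied to [airyA_quotient], which holds in a neighbourhood of [z]
    because the square of the root is continuous there. *)
Lemma qderiv_airyA_quotient (z : C) : z <> 0%C -> 0 < Re (airy_root z * airy_root z) ->
  let rho := Cmod (airy_root z) in let alpha := Re (airy_root z * airy_root z) in
  exists l, qderiv (fun w => airyA w / airyA_WKB w)%C z l /\
    Cmod l <= / (12 * rho ^ 3 * alpha ^ 2) + / (3 * rho * alpha ^ 3).
Proof.
  intros hz ha rho alpha.
  pose proof (qderiv_airy_root_sq z hz ha) as hda.
  pose proof (qderiv_airy_root z hz ha) as hdb.
  destruct (qderiv_wkb_defect _ ha) as (m & hm & hml).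
  assert (hrho : 0 < rho) by (unfold rho; rewrite Cmod_airy_root; apply exp_pos).
  assert (hb0 : airy_root z <> 0%C) by (apply Cmod_gt_0, hrho).
  assert (h20 : RtoC 2 <> 0%C) by (intros h; apply RtoC_inj in h; lra).
  assert (hnear : exists r, 0 < r /\ forall h, Cmod h < r ->
    (z + h)%C <> 0%C /\ 0 < Re (airy_root (z + h) * airy_root (z + h))).
  { destruct (qderiv_lipschitz _ _ _ hda) as (K & d & hK & hd & hl). cbv beta in hl.
    exists (Rmin (Cmod z) (Rmin d (alpha / (K + 1)))). split.
    { repeat apply Rmin_pos; auto; [apply Cmod_gt_0, hz | apply Rdiv_lt_0_compat; unfold alpha; lra]. }
    intros h hh. apply Rmin_Rgt in hh as [e0 hh]. apply Rmin_Rgt in hh as [e1 e2].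
    split; [apply nonzero_nearby, e0 |].
    specialize (hl h e1).
    apply Rmult_gt_compat_l with (r := K + 1) in e2; [| lra].
    replace ((K + 1) * (alpha / (K + 1))) with alpha in e2 by (field; lra).
    pose proof (Cmod_ge_0 h).
    pose proof (re_le_Cmod (airy_root (z + h) * airy_root (z + h) - airy_root z * airy_root z)) as hre.
    apply (fun h => Rle_trans _ _ _ h hl) in hre.
    unfold alpha in *. revert hre e2.
    generalize (airy_root (z + h) * airy_root (z + h))%C (airy_root z * airy_root z)%C.
    intros [x1 x2] [y1 y2] hre e2. simpl in *. apply Rabs_le_between in hre. lra. }
  destruct hnear as (r & hr & hnear).
  eexists. split.
  - apply (qderiv_ext_loc (fun w => 1 + RtoC (2 / sqrt PI) *
      (airy_root w * wkb_defect (airy_root w * airy_root w)))%C _ _ _ r); auto.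
    { intros h hh. symmetry. destruct (hnear h hh). apply airyA_quotient; auto. }
    apply qderiv_plus; [apply qderiv_const |].
    apply (qderiv_mult (fun _ => RtoC (2 / sqrt PI))); [apply qderiv_const |].
    apply (qderiv_mult airy_root (fun w => wkb_defect (airy_root w * airy_root w)%C)); [exact hdb |].
    apply (qderiv_comp wkb_defect (fun w => airy_root w * airy_root w)%C); [exact hm | exact hda].
  - pose proof two_div_sqrt_PI_bound as hk. cbv beta.
    match goal with |- Cmod ?e <= _ => 
      replace e with (RtoC (2 / sqrt PI) * (cis (- (2 * PI / 3)) *
       (wkb_defect (airy_root z * airy_root z) / (RtoC 4 * (airy_root z * (airy_root z * airy_root z)))
        + m / (RtoC 2 * airy_root z))))%C end.
    2:{ replace (RtoC 4) with (RtoC 2 * RtoC 2)%C by (rewrite <- RtoC_mult; f_equal; ring).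
        field. auto. }
    rewrite !Cmod_mult, Cmod_cis, Cmod_R, (Rabs_pos_eq (2 / sqrt PI)) by lra.
    rewrite Rmult_1_l.
    assert (h40 : RtoC 4 <> 0%C) by (intros h; apply RtoC_inj in h; lra).
    match goal with |- _ * Cmod ?e <= _ =>
      assert (hs : Cmod e <= / (24 * rho ^ 3 * alpha ^ 2) + / (6 * rho * alpha ^ 3)) end.
    { apply Rle_trans with (1 := Cmod_triangle _ _).
      rewrite !Cmod_div by (repeat first [assumption | apply Cmult_neq_0]).
      rewrite !Cmod_mult, !Cmod_R, !Rabs_pos_eq by lra. fold rho.
      pose proof (Cmod_wkb_defect_le _ ha) as hD. fold alpha in hD, hml. unfold alpha in ha. fold alpha in ha.
      apply Rplus_le_compat.
      - replace (/ (24 * rho ^ 3 * alpha ^ 2)) with (/ (6 * alpha ^ 2) / (4 * (rho * (rho * rho)))) by (field; lra).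
        apply Rmult_le_compat_r; auto. apply Rlt_le, Rinv_0_lt_compat.
        repeat apply Rmult_lt_0_compat; lra.
      - replace (/ (6 * rho * alpha ^ 3)) with (/ (3 * alpha ^ 3) / (2 * rho)) by (field; lra).
        apply Rmult_le_compat_r; auto. apply Rlt_le, Rinv_0_lt_compat. lra. }
    apply Rle_trans with (2 * (/ (24 * rho ^ 3 * alpha ^ 2) + / (6 * rho * alpha ^ 3))).
    + apply Rmult_le_compat; auto using Cmod_ge_0; lra.
    + right. unfold alpha in ha. field. unfold alpha; lra.
Qed.

(** The angle of the squared root is half the angle of the rotated [z], hence at most
    [PI / 2 - eps / 2] in absolute value; both values [arg_cut z] and
    [arg_cut z - 2 * PI] of the argument are needed to bound it on the two sides. *)
Lemma Re_airy_root_sq_ge (eps : R) (z : C) : 0 < eps < PI / 6 -> z <> 0%C ->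
  (forall theta : R, is_arg z theta -> ~ (- (PI / 3) - eps < theta < - (PI / 3) + eps)) ->
  Cmod (airy_root z) ^ 2 * sin (eps / 2) <= Re (airy_root z * airy_root z).
Proof.
  intros heps hz harg. rewrite airy_root_sq, Re_real_cis, Cmod_airy_root.
  replace (Rpower (Cmod z) (1 / 4) ^ 2) with (Rpower (Cmod z) (1 / 2)).
  2:{ replace (1 / 2) with (1 / 4 + 1 / 4) by field. rewrite Rpower_plus. ring. }
  apply Rmult_le_compat_l; [apply Rlt_le, exp_pos |].
  destruct (arg_cut_spec z hz) as [hb ha]. pose proof PI_RGT_0.
  assert (h1 : - (PI / 3) + eps <= arg_cut z).
  { pose proof (harg _ ha). lra. }
  assert (h2 : arg_cut z <= 5 * PI / 3 - eps).
  { assert (ha2 : is_arg z (arg_cut z - 2 * PI)).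
    { unfold is_arg in *. rewrite ha at 1. f_equal. unfold cis.
      replace (arg_cut z) with ((arg_cut z - 2 * PI) + 2 * PI) at 1 2 by ring.
      rewrite cos_plus, sin_plus, cos_2PI, sin_2PI. f_equal; ring. }
    pose proof (harg _ ha2). lra. }
  rewrite <- cos_shift. unfold root_angle.
  assert (h3 : forall x, Rabs x <= PI / 2 - eps / 2 -> cos (PI / 2 - eps / 2) <= cos x).
  { intros x hx. replace (cos x) with (cos (Rabs x)).
    - apply cos_decr_1; try lra; apply Rabs_pos.
    - unfold Rabs. destruct (Rcase_abs x); [apply cos_neg | reflexivity]. }
  apply h3, Rabs_le. lra.
Qed.

Theorem theorem2p2 (eps : R) (heps : 0 < eps < PI / 6) (z : C) (hz : z <> RtoC 0)
  (harg : forall theta : R, is_arg z theta ->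
     ~ (- (PI / 3) - eps < theta < - (PI / 3) + eps)) :
  Cmod (airyA z / airyA_WKB z - RtoC 1)%C <=
    3 / Rpower (Cmod z) (3 / 4) * (1 / (sin (eps / 2)) ^ 2) *
    (1 + (ln (1 + Rpower (sin (eps / 2)) (3 / 2) * Rpower (Cmod z) (3 / 4))) ^ 2)
  /\
  ex_derive (K := C_AbsRing) (V := C_NormedModule)
    (fun w : C => (airyA w / airyA_WKB w)%C) z
  /\
  Cmod (C_derive (fun w : C => (airyA w / airyA_WKB w)%C) z) <=
    2 / Rpower (Cmod z) (7 / 4) * (1 / (sin (eps / 2)) ^ 3) *
    (1 + (ln (1 + Rpower (sin (eps / 2)) (3 / 2) * Rpower (Cmod z) (3 / 4))) ^ 3).
Proof.
  set (L := ln (1 + Rpower (sin (eps / 2)) (3 / 2) * Rpower (Cmod z) (3 / 4))).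
  assert (hL : 0 <= L).
  { unfold L. rewrite <- ln_1.
    assert (0 < Rpower (sin (eps / 2)) (3 / 2) * Rpower (Cmod z) (3 / 4))
      by (apply Rmult_lt_0_compat; apply exp_pos).
    apply Rlt_le, ln_increasing; lra. }
  clearbody L.
  pose proof (Re_airy_root_sq_ge eps z heps hz harg) as hal.
  set (S := sin (eps / 2)) in *.
  assert (hS : 0 < S) by (pose proof PI_RGT_0; apply sin_gt_0; lra).
  assert (hS1 : S <= 1) by (apply SIN_bound).
  clearbody S.
  assert (hrho : 0 < Cmod (airy_root z)) by (rewrite Cmod_airy_root; apply exp_pos).
  assert (h3 : Rpower (Cmod z) (3 / 4) = Cmod (airy_root z) ^ 3).
  { rewrite Cmod_airy_root, <- Rpower_pow by apply exp_pos. rewrite Rpower_mult. f_equal. simpl. field. }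
  assert (h7 : Rpower (Cmod z) (7 / 4) = Cmod (airy_root z) ^ 7).
  { rewrite Cmod_airy_root, <- Rpower_pow by apply exp_pos. rewrite Rpower_mult. f_equal. simpl. field. }
  rewrite h3, h7.
  assert (ha : 0 < Re (airy_root z * airy_root z)).
  { apply Rlt_le_trans with (2 := hal). apply Rmult_lt_0_compat; auto. apply pow_lt; auto. }
  assert (hD := Cmod_wkb_defect_le _ ha).
  destruct (qderiv_airyA_quotient z hz ha) as (l & hl & hlb).
  pose proof two_div_sqrt_PI_bound as hk.
  set (rho := Cmod (airy_root z)) in *. set (alpha := Re (airy_root z * airy_root z)) in *.
  assert (hi : forall n, / alpha ^ n <= / (rho ^ 2 * S) ^ n).
  { intros n. assert (0 < rho ^ 2 * S) by (apply Rmult_lt_0_compat; auto; apply pow_lt; auto).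
    apply Rinv_le_contravar; [apply pow_lt; auto | apply pow_incr; lra]. }
  split; [| split].
  - rewrite airyA_quotient by auto.
    match goal with |- Cmod ?e <= _ => replace e with (RtoC (2 / sqrt PI) *
      (airy_root z * wkb_defect (airy_root z * airy_root z)))%C by ring end.
    rewrite !Cmod_mult, Cmod_R, Rabs_pos_eq by lra. fold rho.
    apply Rle_trans with (2 * (rho * (/ 6 * / (rho ^ 2 * S) ^ 2))).
    + apply Rmult_le_compat; [lra | | lra |].
      { apply Rmult_le_pos; [lra | apply Cmod_ge_0]. }
      apply Rmult_le_compat_l; [lra |]. apply Rle_trans with (1 := hD).
      rewrite Rinv_mult. apply Rmult_le_compat_l; [lra | apply hi].
    + replace (2 * (rho * (/ 6 * / (rho ^ 2 * S) ^ 2))) with (/ (rho ^ 3 * S ^ 2) * / 3) by (field; lra).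
      replace (3 / rho ^ 3 * (1 / S ^ 2) * (1 + L ^ 2)) with (/ (rho ^ 3 * S ^ 2) * (3 * (1 + L ^ 2)))
        by (field; lra).
      apply Rmult_le_compat_l.
      * apply Rlt_le, Rinv_0_lt_compat, Rmult_lt_0_compat; apply pow_lt; auto.
      * pose proof (pow2_ge_0 L). lra.
  - exists l. apply qderiv_is_derive, hl.
  - rewrite (is_C_derive_unique _ _ l) by (apply qderiv_is_derive, hl).
    apply Rle_trans with (1 := hlb).
    apply Rle_trans with (/ (12 * rho ^ 3) * / (rho ^ 2 * S) ^ 2 + / (3 * rho) * / (rho ^ 2 * S) ^ 3).
    + rewrite (Rinv_mult (12 * rho ^ 3)), (Rinv_mult (3 * rho)).
      pose proof (pow_lt rho 3 hrho).
      apply Rplus_le_compat; (apply Rmult_le_compat_l; [| apply hi]);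
        apply Rlt_le, Rinv_0_lt_compat; lra.
    + replace (/ (12 * rho ^ 3) * / (rho ^ 2 * S) ^ 2 + / (3 * rho) * / (rho ^ 2 * S) ^ 3)
        with (/ (rho ^ 7 * S ^ 3) * (S / 12 + / 3)) by (field; lra).
      replace (2 / rho ^ 7 * (1 / S ^ 3) * (1 + L ^ 3)) with (/ (rho ^ 7 * S ^ 3) * (2 * (1 + L ^ 3)))
        by (field; lra).
      apply Rmult_le_compat_l.
      * apply Rlt_le, Rinv_0_lt_compat, Rmult_lt_0_compat; apply pow_lt; auto.
      * pose proof (pow_le L 3 hL). lra.
Qed.
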